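(* Let $G$ be a 1-dof tree-decomposable graph with at least six clusters. Then $G$ is nontrivially LCC if and only if $G$ has a construction from some base nonedge such that, for each construction step $v_k\triangleleft(u_k,w_k)$ with $v_k$ in level $L_2$ or a higher level, the pair $(u_k,w_k)$ is contained in an adjacent pair of clusters in some four-cycle of clusters.
   Context: All graphs are finite and simple. A nonedge of a graph $G$ is a pair of distinct vertices not joined by an edge, and $G\cup f$ denotes $G$ with the edge $f$ added. A graph is tree-decomposable if it is a single edge, or it is the union of three tree-decomposable graphs such that each pair shares exactly one vertex and the three shared vertices are distinct. A graph $G$ is 1-dof tree-decomposable if it has a nonedge $f$ such that $G\cup f$ is tree-decomposable; every such $f$ is called a base nonedge of $G$. A cluster of a 1-dof tree-decomposable graph $G$ is a maximal tree-decomposable subgraph of $G$. Construction from a base nonedge $f=(v_0,v_0')$: $G$ is built starting from $G_f(0)$, the graph with the two vertices $v_0,v_0'$ and no edges. At the $k$-th construction step, written $v_k\triangleleft(u_k,w_k)$, two new clusters $T,T'$ of $G$ that share exactly one vertex $v_k$ (the step vertex) are appended to $G_f(k-1)$, where $T\cap G_f(k-1)$ is the single vertex $u_k$, $T'\cap G_f(k-1)$ is the single vertex $w_k$, and $u_k\neq w_k$; the result is $G_f(k)$. The steps may be ordered arbitrarily as long as $u_k,w_k\in G_f(k-1)$ for each $k$. Levels: $L_0=\{v_0,v_0'\}$; $L_1$ is the set of step vertices $v$ with $v\triangleleft(v_0,v_0')$. The two clusters added together with a step vertex in $L_j$ are said to be at level $j$. For $i\ge 2$, $L_i$ is the set of step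 vertices $v$ with $v\triangleleft(u,w)$ such that $i-1=\max(j,m)$, where $j$ and $m$ are the smallest levels of clusters containing $u$ and $w$ respectively. The $k$-th extreme graph $\hat G_f(k)$ is $G_f(k-1)$ with the edge $(u_k,w_k)$ added. $G$ is LCC (has low Cayley complexity) on $f$ if all extreme graphs in the construction of $G$ from $f$ are tree-decomposable; $G$ is LCC if it is LCC on some base nonedge. An LCC graph with fewer than six clusters is called trivially LCC; otherwise it is nontrivially LCC. A four-cycle is a set of four graphs that can be cyclically ordered so that each cyclically consecutive pair shares exactly one vertex and the four shared vertices are distinct. Two of these graphs that share a vertex are called adjacent. A four-cycle of clusters is a four-cycle whose four graphs are clusters. A pair of vertices is contained in an adjacent pair of clusters if both vertices lie in the union of the two clusters.
   Formalization: The four-cycle for a step v_k ◁ (u_k,w_k) is taken among the clusters of G_f(k−1), before the step, since with four-cycles anywhere in G the ''if'' direction fails; step vertices based on (v_0,v_0') count only as L_1, not also as L_2. *)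

(* Defs.v *)
From HB Require Import structures.
From mathcomp Require Import all_boot.

Set Implicit Arguments.
Unset Strict Implicit.
Unset Printing Implicit Defensive.

Definition graph_axiom (T : finType) (VE : {set T} * {set {set T}}) : bool :=
  [forall e in VE.2, (#|e| == 2) && (e \subset VE.1)].

(* Finite simple graphs are taken with vertices in an ambient finite type, so  *)
(* that unions, intersections and subgraphs are the literal set operations;    *)
(* the vertex set need not be the whole type.                                  *)
Record graph (T : finType) := Graph {
  graph_data : {set T} * {set {set T}};
  graphP : graph_axiom graph_data
}.

HB.instance Definition _ (T : finType) := [isSub for @graph_data T].
HB.instance Definition _ (T : finType) := [Finite of graph T by <:].

Section Graphs.

Variable T : finType.
Implicit Types (G H A B C D : graph T) (x y u w : T) (f : T * T).

Definition gV G : {set T} := (graph_data G).1.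
Definition gE G : {set {set T}} := (graph_data G).2.

Lemma gunion_subproof G H : graph_axiom (gV G :|: gV H, gE G :|: gE H).
Proof.
apply/'forall_implyP => e; rewrite inE => /orP[] he.
- have /'forall_implyP/(_ e he)/andP[-> /= s] := graphP G.
  by rewrite (subset_trans s) ?subsetUl.
- have /'forall_implyP/(_ e he)/andP[-> /= s] := graphP H.
  by rewrite (subset_trans s) ?subsetUr.
Qed.

Definition gunion G H : graph T := Graph (gunion_subproof G H).

Lemma gpair_subproof x y : graph_axiom ([set x; y], set0).
Proof. by apply/'forall_implyP => e; rewrite inE. Qed.

Definition gpair x y : graph T := Graph (gpair_subproof x y).

Lemma gedge_subproof x y :
  graph_axiom ([set x; y], [set e in [set [set x; y]] | x != y]).
Proof.
by apply/'forall_implyP => e; rewrite !inE => /andP[/eqP-> nxy]; rewrite cards2 nxy /=.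
Qed.

(* The single edge xy; the filter makes it total, and the edge is absent only  *)
(* in the degenerate case x = y.                                               *)
Definition gedge x y : graph T := Graph (gedge_subproof x y).

Definition add_edge G f : graph T := gunion G (gedge f.1 f.2).

Definition subgraph H G : bool := (gV H \subset gV G) && (gE H \subset gE G).

Definition nonedge G f : bool :=
  [&& f.1 \in gV G, f.2 \in gV G, f.1 != f.2 & [set f.1; f.2] \notin gE G].

Inductive tree_decomposable : graph T -> Prop :=
| td_edge x y : x != y -> tree_decomposable (gedge x y)
| td_union A B C x y z :
    tree_decomposable A -> tree_decomposable B -> tree_decomposable C ->
    gV A :&: gV B = [set x] -> gV B :&: gV C = [set y] ->
    gV A :&: gV C = [set z] -> uniq [:: x; y; z] ->
    tree_decomposable (gunion (gunion A B) C).

Definition base_nonedge G f : Prop :=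
  nonedge G f /\ tree_decomposable (add_edge G f).

Definition one_dof G : Prop := exists f, base_nonedge G f.

Definition cluster G C : Prop :=
  [/\ subgraph C G, tree_decomposable C &
      forall D, subgraph D G -> tree_decomposable D -> subgraph C D -> D = C].

Definition at_least_clusters n G : Prop :=
  exists2 S : {set graph T}, n <= #|S| & forall C, C \in S -> cluster G C.

(* A construction step  step_vertex <| (step_u, step_w), with the two clusters *)
(* it appends: step_T is attached at step_u and step_T' at step_w.             *)
Record step := Step {
  step_vertex : T;
  step_u : T;
  step_w : T;
  step_T : graph T;
  step_T' : graph T
}.

Definition append_step H (st : step) : graph T :=
  gunion (gunion H (step_T st)) (step_T' st).

Definition valid_step G H (st : step) : Prop :=
  [/\ cluster G (step_T st) /\ cluster G (step_T' st),
      gV (step_T st) :&: gV (step_T' st) = [set step_vertex st],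
      gV (step_T st) :&: gV H = [set step_u st],
      gV (step_T' st) :&: gV H = [set step_w st] &
      step_u st != step_w st].

(* G_f(k), the graph after the first k steps of s.                             *)
Definition stage f (s : seq step) (k : nat) : graph T :=
  foldl append_step (gpair f.1 f.2) (take k s).

(* Steps are indexed from 0: step k is performed on stage f s k.               *)
Definition step_at (s : seq step) (k : 'I_(size s)) : step :=
  tnth (in_tuple s) k.

Definition construction G f (s : seq step) : Prop :=
  [/\ base_nonedge G f,
      forall k : 'I_(size s), valid_step G (stage f s k) (step_at k) &
      stage f s (size s) = G].

Definition contains_step (st : step) x : bool :=
  (x \in gV (step_T st)) || (x \in gV (step_T' st)).

(* With Ls = [:: L_0; ...; L_j], the smallest level of a cluster containing x, *)
(* if it is at most j, and j + 1 otherwise.                                    *)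
Definition min_level (s : seq step) (Ls : seq {set T}) x : nat :=
  find (fun L : {set T} =>
          has (fun st => (step_vertex st \in L) && contains_step st x) s) Ls.

Definition based_on f (st : step) : bool :=
  [set step_u st; step_w st] == [set f.1; f.2].

Definition next_level f (s : seq step) (j : nat) (Ls : seq {set T}) : {set T} :=
  [set v | has (fun st =>
     (step_vertex st == v) &&
     (if j == 0 then based_on f st
      else ~~ based_on f st &&
           (maxn (min_level s Ls (step_u st)) (min_level s Ls (step_w st)) == j)))
     s].

(* [:: L_0; ...; L_i].  Membership in L_(j+1) only depends on whether the      *)
(* smallest levels are at most j, so L_0, ..., L_j suffice to decide it.  The  *)
(* vertices of L_1 are kept out of the higher levels: the end points of the    *)
(* base nonedge lie in clusters at level 1, so the defining equation of L_2    *)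
(* alone would capture L_1 again.                                              *)
Fixpoint levels f (s : seq step) (i : nat) : seq {set T} :=
  if i is j.+1 then
    let Ls := levels f s j in rcons Ls (next_level f s j Ls)
  else [:: [set f.1; f.2]].

Definition level f (s : seq step) (i : nat) : {set T} := nth set0 (levels f s i) i.

Definition extreme_graph f (s : seq step) (k : 'I_(size s)) : graph T :=
  add_edge (stage f s k) (step_u (step_at k), step_w (step_at k)).

(* The construction from f is unique up to the order of its steps, which is    *)
(* arbitrary; hence the existential.                                           *)
Definition lcc_on G f : Prop :=
  exists2 s, construction G f s &
    forall k : 'I_(size s), tree_decomposable (extreme_graph f k).

Definition lcc G : Prop := exists f, lcc_on G f.

Definition trivially_lcc G : Prop := lcc G /\ ~ at_least_clusters 6 G.

Definition nontrivially_lcc G : Prop := lcc G /\ ~ trivially_lcc G.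

Definition four_cycle (S : {set graph T}) : Prop :=
  #|S| = 4 /\
  exists A B C D, S = [set A; B; C; D] /\
  exists a b c d,
    [/\ gV A :&: gV B = [set a], gV B :&: gV C = [set b],
        gV C :&: gV D = [set c], gV D :&: gV A = [set d] &
        uniq [:: a; b; c; d]].

(* When a step is performed on H = G_f(k-1), its four-cycle of clusters is     *)
(* taken in H, i.e. among the clusters already constructed: clusters appended  *)
(* by this step or by later ones do not count.                                 *)
Definition four_cycle_of_clusters H (S : {set graph T}) : Prop :=
  four_cycle S /\ forall C, C \in S -> cluster H C.

Definition adjacent (S : {set graph T}) A B : Prop :=
  [/\ A \in S, B \in S, A != B & gV A :&: gV B != set0].

Definition in_adjacent_pair (S : {set graph T}) u w : Prop :=
  exists A B, adjacent S A B /\ [set u; w] \subset gV A :|: gV B.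

End Graphs.

(* Main.v *)
Require Import Defs.
From mathcomp Require Import all_boot.
From Stdlib Require Import Classical_Prop.

(** Everything rests on one dichotomy: if a tree-decomposable (td) graph is
    the union of three td graphs meeting pairwise in distinct vertices, then a
    td subgraph lies in one of the three or meets each of them in a td graph.
    Consequently td subgraphs of a td graph that share two vertices have a td
    union, every proper td subgraph D extends to a td triple D, A, B, and a td
    subgraph may be replaced by any td graph on the same vertices.

    If H + uw is td, extending the edge uw once gives adjacent clusters of H
    containing u and w; extending again closes a four-cycle, which is possible
    as soon as H has at least three clusters.  This covers all steps but the
    first two; for these, the base nonedge is changed to the pair (u, w) of
    the second step, which alters nothing but the first step and puts both
    step vertices in L_1.

    Conversely, a four-cycle of clusters created by a step v <| (u, w) has the
    form T, T', C, D with u in D and w in C.  Its union Q is made td by uw and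
    by any pair contained in adjacent clusters, so the two resulting graphs
    can be exchanged inside the extreme graph of that step; later steps
    preserve tree-decomposability. *)

Set Implicit Arguments.
Unset Strict Implicit.
Unset Printing Implicit Defensive.

Section Graphs.

Variable T : finType.
Implicit Types (A B C D G H K R : graph T) (x y z u v w : T) (f : T * T).
Implicit Types (F : 'I_3 -> graph T).

Local Notation td := (@tree_decomposable T).

(** * Subgraphs, unions and single edges *)

Lemma graph_eq G H : gV G = gV H -> gE G = gE H -> G = H.
Proof.
case: G H => [[VG EG] GP] [[VH EH] HP]; rewrite /gV /gE /= => eV eE.
by apply: val_inj; rewrite /= eV eE.
Qed.

Lemma edgeP G e : e \in gE G -> #|e| = 2 /\ e \subset gV G.
Proof. by move=> he; have /'forall_implyP/(_ e he)/andP[/eqP] := graphP G. Qed.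

Lemma subgraphP A B :
  reflect ({subset gV A <= gV B} /\ {subset gE A <= gE B}) (subgraph A B).
Proof. by apply: (iffP andP) => -[/subsetP ? /subsetP]. Qed.

Lemma subV A B : subgraph A B -> {subset gV A <= gV B}.
Proof. by case/subgraphP=> s _. Qed.

Lemma subE A B : subgraph A B -> {subset gE A <= gE B}.
Proof. by case/subgraphP=> _ s. Qed.

Lemma subgraph_refl A : subgraph A A.
Proof. by rewrite /subgraph !subxx. Qed.

Lemma subgraph_trans B A C : subgraph A B -> subgraph B C -> subgraph A C.
Proof.
move=> /subgraphP[sV sE] /subgraphP[sV' sE'].
by apply/subgraphP; split=> a h; [apply/sV'/sV | apply/sE'/sE].
Qed.

Lemma subgraph_anti A B : subgraph A B -> subgraph B A -> A = B.
Proof.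
move=> /andP[s1 s2] /andP[s3 s4].
by apply: graph_eq; apply/eqP; rewrite eqEsubset ?s1 ?s2.
Qed.

Lemma gV_union A B : gV (gunion A B) = gV A :|: gV B.
Proof. by []. Qed.

Lemma gunion_sub A B C : subgraph (gunion A B) C = subgraph A C && subgraph B C.
Proof. by rewrite /subgraph /= !subUset andbACA. Qed.

Lemma subgraph_unionl A B : subgraph A (gunion A B).
Proof. by rewrite /subgraph !subsetUl. Qed.

Lemma subgraph_unionr A B : subgraph B (gunion A B).
Proof. by rewrite /subgraph !subsetUr. Qed.

Lemma gunionC A B : gunion A B = gunion B A.
Proof. by apply: graph_eq; apply: setUC. Qed.

Lemma gunionA A B C : gunion A (gunion B C) = gunion (gunion A B) C.
Proof. by apply: graph_eq; apply: setUA. Qed.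

Lemma gunionAC A B C : gunion (gunion A B) C = gunion (gunion A C) B.
Proof. by apply: graph_eq; apply: setUAC. Qed.

Lemma gunion_idr A B : subgraph B A -> gunion A B = A.
Proof. by case/andP => *; apply: graph_eq; apply/setUidPl. Qed.

Lemma gedgeC x y : gedge x y = gedge y x.
Proof.
by apply: graph_eq; [exact: setUC | apply/setP=> e; rewrite !inE setUC [x == y]eq_sym].
Qed.

Lemma gE_gedge x y : x != y -> gE (gedge x y) = [set [set x; y]].
Proof. by move=> nxy; apply/setP=> e; rewrite !inE nxy andbT. Qed.

Lemma gedge_sub x y G : [set x; y] \in gE G -> subgraph (gedge x y) G.
Proof.
move=> he; apply/andP; split; first by case: (edgeP he).
by apply/subsetP => e; rewrite !inE => /andP[/eqP->].
Qed.

Lemma capP A B x :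
  gV A :&: gV B = [set x] <->
  [/\ x \in gV A, x \in gV B & forall a, a \in gV A -> a \in gV B -> a = x].
Proof.
split=> [/setP e|[xA xB uq]].
  have := e x; rewrite !inE eqxx => /andP[? ?]; split=> // a aA aB.
  by apply/eqP; have := e a; rewrite !inE aA aB => /esym.
apply/setP=> a; rewrite !inE; apply/idP/eqP => [/andP[]|->]; [exact: uq | exact/andP].
Qed.

(** * First facts on td graphs and one-vertex intersections *)

Lemma td_edge_mem D : td D -> exists2 e, e \in gE D & #|e| = 2.
Proof.
elim=> [x y nxy|A B C x y z _ [e eA ce] _ _ _ _ _ _ _ _].
  by exists [set x; y]; rewrite ?cards2 ?nxy // gE_gedge ?inE.
by exists e => //; rewrite !inE eA.
Qed.

Lemma td_other D x : td D -> exists2 y, y \in gV D & y != x.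
Proof.
move=> tD; have [e eD /eqP/cards2P[a [b [nab de]]]] := td_edge_mem tD; subst e.
have [_ /subsetP s] := edgeP eD.
case: (eqVneq a x) nab => [<-|nax] nab.
  by exists b; rewrite 1?eq_sym //; apply: s; rewrite !inE eqxx orbT.
by exists a => //; apply: s; rewrite !inE eqxx.
Qed.

Lemma td_cap_not_sub A B x :
  td B -> gV A :&: gV B = [set x] -> ~~ subgraph B A.
Proof.
move=> tB /capP[_ _ uq]; apply/negP=> /subV s.
by have [y yB] := td_other x tB; rewrite (uq y) ?eqxx ?s.
Qed.

Lemma edge_cap A B e :
  (forall a b, a \in gV A -> b \in gV A -> a \in gV B -> b \in gV B -> a = b) ->
  e \in gE A -> e \notin gE B.
Proof.
move=> uq eA; apply/negP=> eB.
have [/eqP/cards2P[a [b [nab def_e]]] /subsetP sA] := edgeP eA.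
have [_ /subsetP sB] := edgeP eB.
have [ae be] : a \in e /\ b \in e by rewrite def_e !inE !eqxx orbT.
by rewrite (uq a b) ?eqxx ?sA ?sB in nab.
Qed.

Lemma td_sub_edge D x y : td D -> subgraph D (gedge x y) -> D = gedge x y.
Proof.
move=> tD s; apply: subgraph_anti => //; apply: gedge_sub.
have [e eD _] := td_edge_mem tD.
by have := subE s eD; rewrite !inE => /andP[/eqP<-].
Qed.

(** * Triples of graphs meeting pairwise in distinct vertices *)

Definition tri A B C x y z : Prop :=
  [/\ gV A :&: gV B = [set x], gV B :&: gV C = [set y],
      gV A :&: gV C = [set z] & uniq [:: x; y; z]].

Lemma tri_rot A B C x y z : tri A B C x y z -> tri B C A y z x.
Proof.
by case=> eAB eBC eAC uq; split; rewrite // 1?setIC // -(rot_uniq 2).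
Qed.

Lemma td_tri A B C x y z :
  td A -> td B -> td C -> tri A B C x y z -> td (gunion (gunion A B) C).
Proof. by move=> tA tB tC [*]; apply: (td_union tA tB tC) => //; eassumption. Qed.

(** Indexing by ['I_3] makes the three members interchangeable, so one argument about an index
    covers all positions; [fam] turns an explicit triple into such a family. *)
Definition gbig F : graph T :=
  gunion (gunion (F ord0) (F (inord 1))) (F (inord 2)).

Lemma ord3P (P : 'I_3 -> Prop) :
  (exists i, P i) <-> P ord0 \/ P (inord 1) \/ P (inord 2).
Proof.
split=> [[i Pi]|[|[]] Pi]; try by eexists; exact: Pi.
case: i => -[|[|[|//]]] hi in Pi *; [left|right; left|right; right].
all: by congr P: Pi; apply: val_inj; rewrite /= ?inordK.
Qed.

Lemma gbigV F x : x \in gV (gbig F) <-> exists i, x \in gV (F i).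
Proof. by rewrite ord3P !inE -orbA; split=> [/or3P[]|[|[]]->]; rewrite ?orbT; auto. Qed.

Lemma gbigE F e : e \in gE (gbig F) <-> exists i, e \in gE (F i).
Proof. by rewrite ord3P !inE -orbA; split=> [/or3P[]|[|[]]->]; rewrite ?orbT; auto. Qed.

Lemma gbig_sub F i : subgraph (F i) (gbig F).
Proof. by apply/subgraphP; split=> a h; [apply/gbigV|apply/gbigE]; exists i. Qed.

Lemma sub_gbig F G : (forall i, subgraph (F i) G) -> subgraph (gbig F) G.
Proof.
by move=> s; apply/subgraphP; split=> a; [case/gbigV|case/gbigE] => i;
  have [sV sE] := subgraphP _ _ (s i); auto.
Qed.

(* As the members meet pairwise in one vertex, the three shared vertices are *)
(* distinct iff no vertex is common to all three.                            *)
Definition triangle F : Prop :=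
  (forall i j, i != j -> exists x, gV (F i) :&: gV (F j) = [set x]) /\
  (forall x, exists i, x \notin gV (F i)).

Lemma td_gbig F : (forall i, td (F i)) -> triangle F -> td (gbig F).
Proof.
move=> tF [F2 F3].
have [|x e01] := F2 ord0 (inord 1); first by rewrite -val_eqE /= inordK.
have [|y e12] := F2 (inord 1) (inord 2); first by rewrite -val_eqE /= !inordK.
have [|z e02] := F2 ord0 (inord 2); first by rewrite -val_eqE /= inordK.
apply: (td_union (tF _) (tF _) (tF _) e01 e12 e02).
have [x0 x1 _] := (capP _ _ _).1 e01; have [y1 y2 _] := (capP _ _ _).1 e12.
have [z0 z2 _] := (capP _ _ _).1 e02.
have no3 t : t \in gV (F ord0) -> t \in gV (F (inord 1)) ->
    t \in gV (F (inord 2)) -> False.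
  move=> t0 t1 t2; have /ord3P := F3 t.
  by rewrite t0 t1 t2 /=; case=> [|[]].
rewrite /= !inE negb_or !andbT; apply/andP; split; [apply/andP; split|];
  by apply/eqP=> e; subst; eauto.
Qed.

Definition fam A B C (i : 'I_3) : graph T :=
  match val i with 0 => A | 1 => B | _ => C end.

Lemma gbig_fam A B C : gbig (fam A B C) = gunion (gunion A B) C.
Proof. by rewrite /gbig /fam /= !inordK. Qed.

Lemma triangle_fam A B C x y z : tri A B C x y z -> triangle (fam A B C).
Proof.
case=> eAB eBC eAC; rewrite /= !inE negb_or andbT => /andP[/andP[nxy nxz] nyz].
split=> [[[|[|[|//]]] hi] [[|[|[|//]]] hj]|t]; rewrite -?val_eqE //= ?[_ :&: gV A]setIC;
  rewrite ?[gV C :&: gV B]setIC ?eAB ?eBC ?eAC; try by eexists.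
case tA: (t \in gV A); last by exists ord0; rewrite /fam /= tA.
case tB: (t \in gV B); last by exists (inord 1); rewrite /fam /= inordK ?tB.
exists (inord 2); rewrite /fam /= inordK //; apply/negP => tC.
have [_ _ u1] := (capP _ _ _).1 eAB; have [_ _ u2] := (capP _ _ _).1 eBC.
by rewrite -(u1 t) // -(u2 t) ?eqxx in nxy.
Qed.

Lemma td_ind3 (P : graph T -> Prop) :
  (forall x y, x != y -> P (gedge x y)) ->
  (forall F, (forall i, td (F i)) -> (forall i, P (F i)) -> triangle F ->
     P (gbig F)) ->
  forall D, td D -> P D.
Proof.
move=> P2 P3 D; elim=> // A B C x y z tA PA tB PB tC PC eAB eBC eAC uq.
rewrite -gbig_fam; apply: P3; last by apply: (@triangle_fam _ _ _ x y z); split.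
  by case=> -[|[|[|]]].
by case=> -[|[|[|]]].
Qed.

(** Members may shrink as long as they keep their corners, the vertices shared with other
    members. *)
Lemma triangle_inner F F' :
  triangle F -> (forall i, subgraph (F' i) (F i)) ->
  (forall i j x, i != j -> x \in gV (F i) -> x \in gV (F j) -> x \in gV (F' i)) ->
  triangle F'.
Proof.
move=> [F2 F3] s sh; split=> [i j nij|x].
  have [x /capP[xi xj uq]] := F2 i j nij; exists x; apply/capP; split.
  - exact: sh nij xi xj.
  - by rewrite eq_sym in nij; apply: sh nij xj xi.
  - by move=> a /(subV (s i)) ai /(subV (s j)); apply: uq.
by have [i ni] := F3 x; exists i; apply: contra ni => /(subV (s i)).
Qed.

Lemma ord3_others (i : 'I_3) : exists j l, [/\ i != j, i != l & j != l].
Proof.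
have [h1 h2] : (inord 1 : 'I_3) = 1 :> nat /\ (inord 2 : 'I_3) = 2 :> nat.
  by rewrite !inordK.
case: i => -[|[|[|//]]] hi.
- by exists (inord 1), (inord 2); rewrite -!val_eqE /= h1 h2.
- by exists ord0, (inord 2); rewrite -!val_eqE /= h2.
- by exists ord0, (inord 1); rewrite -!val_eqE /= h1.
Qed.

Lemma ord3_cover (i j l m : 'I_3) :
  i != j -> i != l -> j != l -> [\/ m = i, m = j | m = l].
Proof.
rewrite -!val_eqE => nij nil njl; have eqo := @val_inj _ _ 'I_3.
suff [] : [\/ val m = val i, val m = val j | val m = val l]; first
  by move=> /eqo->; constructor.
- by move=> /eqo->; constructor 2.
- by move=> /eqo->; constructor 3.
move: i j l m nij nil njl => -[[|[|[|//]]] hi] [[|[|[|//]]] hj] [[|[|[|//]]] hl]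
  [[|[|[|//]]] hm] //= _ _ _; by [constructor 1 | constructor 2 | constructor 3].
Qed.

Lemma gbig_others F i j l :
  i != j -> i != l -> j != l -> gbig F = gunion (gunion (F i) (F j)) (F l).
Proof.
move=> nij nil njl; apply: subgraph_anti.
  apply: sub_gbig => m; have [|-> | ->] := ord3_cover m nij nil njl.
  - by move=> ->; rewrite -gunionA subgraph_unionl.
  - by rewrite gunionAC subgraph_unionr.
  - exact: subgraph_unionr.
by rewrite !gunion_sub !gbig_sub.
Qed.

(** * Splitting td subgraphs along a triangle *)

(** The case of the dichotomy where [D] meets every member: [F' i] is the part of [D] in [F i], and
    the last clause puts all corners into the parts. *)
Definition split_along F D : Prop :=
  exists F', [/\ forall i, td (F' i), forall i, subgraph (F' i) (F i),
    D = gbig F' &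
    forall i j x, i != j -> x \in gV (F i) -> x \in gV (F j) -> x \in gV (F' i)].

Lemma split_mem F D i j x : split_along F D -> i != j ->
  x \in gV (F i) -> x \in gV (F j) -> x \in gV D.
Proof.
move=> [F' [_ _ -> sh]] nij xi xj; apply/gbigV; exists i; exact: sh nij xi xj.
Qed.

Lemma split_part F F' i x :
  (forall i, subgraph (F' i) (F i)) ->
  (forall i j x, i != j -> x \in gV (F i) -> x \in gV (F j) -> x \in gV (F' i)) ->
  x \in gV (gbig F') -> x \in gV (F i) -> x \in gV (F' i).
Proof.
move=> s sh /gbigV[j xj] xi; case: (eqVneq i j) => [->|nij] //.
exact: sh nij xi (subV (s j) xj).
Qed.

(** [A] contains every corner of [F], so [B] and [C], each meeting [A] in one vertex, cannot be
    split too and lie inside members. Different members would make the common vertex of [B] and [C]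
    a corner, hence a vertex of [A]; so both lie in one [F j], and only the piece there grows. *)
Lemma split_step F A B C x y z :
  triangle F -> td A -> td B -> td C -> tri A B C x y z -> split_along F A ->
  (exists i, subgraph B (F i)) \/ split_along F B ->
  (exists i, subgraph C (F i)) \/ split_along F C ->
  split_along F (gunion (gunion A B) C).
Proof.
move=> [F2 F3] tA tB tC [eAB eBC eAC uq] sA.
(* If a split [E] met [A] in [t] alone, every corner would be [t], a vertex common to all three
   members. *)
have ns E t : gV A :&: gV E = [set t] -> ~ split_along F E.
  move=> /capP[_ _ uqE] sE.
  have [p p01] := F2 ord0 (inord 1) ltac:(by rewrite -val_eqE /= inordK).
  have [q q12] := F2 (inord 1) (inord 2) ltac:(by rewrite -val_eqE /= !inordK).
  have [p0 p1 _] := (capP _ _ _).1 p01; have [q1 q2 _] := (capP _ _ _).1 q12.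
  have n01 : ord0 != inord 1 :> 'I_3 by rewrite -val_eqE /= inordK.
  have n12 : inord 1 != inord 2 :> 'I_3 by rewrite -val_eqE /= !inordK.
  have pt : p = t by apply: uqE; apply: split_mem n01 p0 p1.
  have qt : q = t by apply: uqE; apply: split_mem n12 q1 q2.
  subst p q; have /ord3P := F3 t.
  by rewrite p0 p1 q2; case=> [|[]].
case=> [[j sB]|sB]; last by case: (ns _ _ eAB sB).
case=> [[l sC]|sC]; last by case: (ns _ _ eAC sC).
have [xA xB uAB] := (capP _ _ _).1 eAB; have [yB yC uBC] := (capP _ _ _).1 eBC.
have [zA zC uAC] := (capP _ _ _).1 eAC.
case: (eqVneq j l) => [jl|njl]; last first.
  have yA : y \in gV A := split_mem sA njl (subV sB yB) (subV sC yC).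
  by move: uq; rewrite /= !inE (uAB y) ?eqxx.
subst l; case: sA => F' [tF' sF' defA sh].
have inA t : t \in gV A -> t \in gV (F j) -> t \in gV (F' j).
  by rewrite defA; apply: split_part.
have sFA : subgraph (F' j) A by rewrite defA gbig_sub.
exists (fun i => if i == j then gunion (gunion (F' j) B) C else F' i); split.
- move=> i; case: eqP => // _; apply: (td_tri (x := x) (y := y) (z := z)) => //.
  split=> //; apply/capP; split=> //.
  + exact: inA (subV sB xB).
  + by move=> a /(subV sFA); apply: uAB.
  + exact: inA (subV sC zC).
  + by move=> a /(subV sFA); apply: uAC.
- by move=> i; case: eqP => [->|//]; rewrite !gunion_sub sF' sB sC.
- apply: subgraph_anti.
    set F1 := fun i => _.
    have : subgraph (F1 j) (gbig F1) by apply: gbig_sub.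
    rewrite {1}/F1 eqxx !gunion_sub => /andP[/andP[sj -> ->]].
    rewrite !andbT defA; apply: sub_gbig => i; case: (eqVneq i j) => [->//|nij].
    by have := gbig_sub F1 i; rewrite {1}/F1 (negPf nij).
  have [sAU sBU sCU] : [/\ subgraph A (gunion (gunion A B) C),
      subgraph B (gunion (gunion A B) C) & subgraph C (gunion (gunion A B) C)].
    by have := subgraph_refl (gunion (gunion A B) C);
      rewrite {1}gunion_sub gunion_sub => /andP[/andP[]].
  apply: sub_gbig => i; have sFU k : subgraph (F' k) (gunion (gunion A B) C).
    by apply: subgraph_trans sAU; rewrite defA gbig_sub.
  by case: eqP => _; rewrite // [subgraph (gunion _ C) _]gunion_sub gunion_sub sFU sBU.
- move=> i k t nik ti tk; case: eqP => [eij|_]; last exact: sh nik ti tk.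
  by subst i; rewrite !inE (sh j k).
Qed.

(** Induction on [D]. If one of its three parts is split, [split_step] applies up to rotation. If
    all lie inside members, they lie in one member or in three different ones; in the latter case
    the corners of [D] are those of [F]. *)
Lemma td_split F D : td D -> triangle F -> subgraph D (gbig F) ->
  (exists i, subgraph D (F i)) \/ split_along F D.
Proof.
move=> tD tF; elim: tD => [x y nxy|A B C x y z tA IHA tB IHB tC IHC eAB eBC eAC uq].
  move=> /subE/(_ [set x; y]); rewrite gE_gedge // inE eqxx => /(_ isT)/gbigE[i hi].
  by left; exists i; apply: gedge_sub.
rewrite !gunion_sub => /andP[/andP[/IHA hA /IHB hB] /IHC hC].
have trABC : tri A B C x y z by split.
case: (hA) => [[i sA]|sA]; last by right; apply: split_step trABC sA hB hC.
case: (hB) => [[j sB]|sB]; last first.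
  right; rewrite -gunionA gunionC.
  by apply: split_step (tri_rot trABC) sB hC hA.
case: (hC) => [[l sC]|sC]; last first.
  right; rewrite gunionC gunionA; apply: split_step (tri_rot (tri_rot trABC)) sC hA hB => //.
have [xA xB _] := (capP _ _ _).1 eAB; have [yB yC _] := (capP _ _ _).1 eBC.
have [zA zC _] := (capP _ _ _).1 eAC; have [F2 _] := tF.
move: (uq); rewrite /= !inE negb_or andbT => /andP[/andP[nxy nxz] nyz].
(* Two parts in one member and the third in another would give these members two common vertices. *)
have two a b p q : a != b -> p != q -> a \in gV (F p) -> b \in gV (F p) ->
    a \in gV (F q) -> b \in gV (F q) -> False.
  move=> nab npq ap bp aq bq; have [t /capP[_ _ u]] := F2 p q npq.
  by case/eqP: nab; rewrite (u a ap aq) (u b bp bq).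
case: (eqVneq i j) => [eij|nij].
  subst j; case: (eqVneq i l) => [eil|nil]; first by
    subst l; left; exists i; rewrite !gunion_sub sA sB sC.
  by case: (two y z i l nyz nil (subV sB yB) (subV sA zA) (subV sC yC) (subV sC zC)).
case: (eqVneq i l) => [eil|nil].
  by subst l; case: (two x y i j nxy nij (subV sA xA) (subV sC yC) (subV sB xB) (subV sB yB)).
case: (eqVneq j l) => [ejl|njl].
  by subst l; case: (two x z i j nxz nij (subV sA xA) (subV sA zA) (subV sB xB) (subV sC zC)).
right; pose F1 m := if m == i then A else if m == j then B else C.
have F1i : F1 i = A by rewrite /F1 eqxx.
have F1j : F1 j = B by rewrite /F1 eqxx eq_sym (negPf nij).
have F1l : F1 l = C by rewrite /F1 [l == i]eq_sym [l == j]eq_sym (negPf nil) (negPf njl).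
exists F1; split.
- by move=> m; rewrite /F1; do 2?case: ifP.
- by move=> m; have [|->|->] := ord3_cover m nij nil njl; [move=> ->| |]; rewrite ?F1i ?F1j ?F1l.
- by rewrite (gbig_others _ nij nil njl) F1i F1j F1l.
move=> p q t npq tp tq.
have key a b e : a != b -> e \in gV (F a) -> e \in gV (F b) ->
    t \in gV (F a) -> t \in gV (F b) -> t = e.
  move=> nab ea eb ta tb; have [r /capP[_ _ u]] := F2 a b nab.
  by rewrite (u t ta tb) (u e ea eb).
have [kx ky kz] : [/\ t \in gV (F i) -> t \in gV (F j) -> t = x,
    t \in gV (F j) -> t \in gV (F l) -> t = y &
    t \in gV (F i) -> t \in gV (F l) -> t = z].
  split; [exact: key nij (subV sA xA) (subV sB xB)
    | exact: key njl (subV sB yB) (subV sC yC)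
    | exact: key nil (subV sA zA) (subV sC zC)].
move: npq tp tq.
have [|->|->] := ord3_cover p nij nil njl; [move=> ->| |];
have [|->|->] := ord3_cover q nij nil njl; try (move=> ->); rewrite ?eqxx // => _ tp tq;
rewrite ?F1i ?F1j ?F1l;
  first [rewrite (kx tp tq) | rewrite (kx tq tp) | rewrite (ky tp tq)
    | rewrite (ky tq tp) | rewrite (kz tp tq) | rewrite (kz tq tp)]; assumption.
Qed.

(** * Joining, extending and exchanging td subgraphs *)

Lemma gunion_gbig F F' :
  gunion (gbig F) (gbig F') = gbig (fun i => gunion (F i) (F' i)).
Proof.
by apply: graph_eq; apply/setP => a; rewrite !inE; do !case: (a \in _).
Qed.

Lemma triangle_two F i : triangle F -> exists x y j l,
  [/\ x != y, i != j, i != l & [/\ x \in gV (F i), x \in gV (F j),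
    y \in gV (F i) & y \in gV (F l)]].
Proof.
move=> [F2 F3]; have [j [l [nij nil njl]]] := ord3_others i.
have [x /capP[xi xj _]] := F2 i j nij; have [y /capP[yi yl _]] := F2 i l nil.
exists x, y, j, l; split=> //; apply/eqP => exy; subst y.
have [k] := F3 x.
by have [|->|->] := ord3_cover k nij nil njl; rewrite ?xj ?yl // => ->; rewrite xi.
Qed.

(** [A] meets [D] only in the piece of [D] inside [F i]; the two are joined there and the other
    pieces are kept. *)
Lemma split_join_part F A D i :
  triangle F -> (forall D, td D -> subgraph D (F i) -> forall x y, x != y ->
     x \in gV A -> y \in gV A -> x \in gV D -> y \in gV D -> td (gunion A D)) ->
  subgraph A (F i) -> split_along F D -> forall x y, x != y ->
  x \in gV A -> y \in gV A -> x \in gV D -> y \in gV D -> td (gunion A D).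
Proof.
move=> tF IH sA [F' [tF' sF' defD sh]] x y nxy xA yA xD yD.
have inD t : t \in gV D -> t \in gV A -> t \in gV (F' i).
  by rewrite defD => tD /(subV sA); apply: split_part.
pose F1 j := if j == i then gunion A (F' i) else F' j.
suff -> : gunion A D = gbig F1.
  apply: td_gbig.
    move=> j; rewrite /F1; case: eqP => // _.
    by apply: (IH _ (tF' i) (sF' i) x y); rewrite ?inD.
  apply: (triangle_inner tF) => [j|j k t njk tj tk]; rewrite /F1.
    by case: eqP => // ->; rewrite gunion_sub sA sF'.
  case: eqP => [ej|_]; last exact: sh njk tj tk.
  by subst j; rewrite inE (sh i k) ?orbT.
have sF1 : subgraph (gunion A (F' i)) (gbig F1).
  by have := gbig_sub F1 i; rewrite {1}/F1 eqxx.
apply: subgraph_anti.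
  move: sF1; rewrite !gunion_sub defD => /andP[-> sF1]; apply: sub_gbig => j.
  by case: (eqVneq j i) => [-> //|nij]; have := gbig_sub F1 j; rewrite {1}/F1 (negPf nij).
have sFU j : subgraph (F' j) (gunion A D).
  by apply: (subgraph_trans _ (subgraph_unionr A D)); rewrite defD gbig_sub.
apply: sub_gbig => j; rewrite /F1; case: eqP => // _.
by rewrite gunion_sub subgraph_unionl sFU.
Qed.

(** Induction on [K], with both graphs placed or split along its decomposition. Different members do
    not share two vertices, so every join takes place within a member. *)
Lemma td_join K A B x y : td K -> td A -> td B -> subgraph A K -> subgraph B K ->
  x != y -> x \in gV A -> y \in gV A -> x \in gV B -> y \in gV B ->
  td (gunion A B).
Proof.
move=> tK; elim/td_ind3: tK A B x y => [p q npq|F tF IH trF] A B x y tA tB sA sB.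
  rewrite (td_sub_edge tA sA) (td_sub_edge tB sB) gunion_idr ?subgraph_refl // => *.
  exact: td_edge.
move=> nxy xA yA xB yB.
case: (td_split tA trF sA) => [[i sAi]|spA].
  case: (td_split tB trF sB) => [[j sBj]|spB].
    case: (eqVneq i j) => [eij|nij]; first by subst j; apply: (IH i A B x y).
    have [t /capP[_ _ u]] := trF.1 i j nij.
    by case/eqP: nxy; rewrite (u x (subV sAi xA) (subV sBj xB))
      (u y (subV sAi yA) (subV sBj yB)).
  apply: (split_join_part trF _ sAi spB nxy) => // D tD sD p q npq *.
  exact: (IH i A D p q).
case: (td_split tB trF sB) => [[j sBj]|spB].
  rewrite gunionC; apply: (split_join_part trF _ sBj spA nxy) => // D tD sD p q npq *.
  exact: (IH j B D p q).
case: spA spB => [FA [tFA sFA -> shA]] [FB [tFB sFB -> shB]].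
rewrite gunion_gbig; apply: td_gbig => [i|].
  (* The two corners of [F i] lie in both pieces, so induction applies to the pieces. *)
  have [p [q [j [l [npq nij nil [pi pj qi ql]]]]]] := triangle_two i trF.
  apply: (IH i _ _ p q) => //; [exact: shA nij pi pj | exact: shA nil qi ql |
    exact: shB nij pi pj | exact: shB nil qi ql].
apply: (triangle_inner trF) => [i|i j t nij ti tj]; first by rewrite gunion_sub sFA sFB.
by rewrite inE (shA i j).
Qed.

(** Induction on [K]. A whole member is completed by the other two. If [D] is split, some piece is
    smaller than its member, and the triple found there also fits [D], which has no further vertices
    in that member. *)
Lemma td_extend K D : td K -> td D -> subgraph D K -> D != K ->
  exists A B x y z, [/\ td A, td B, subgraph A K, subgraph B K & tri D A B x y z].
Proof.
move=> tK; elim/td_ind3: tK D => [p q npq|F tF IH trF] D tD sD nDK.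
  by rewrite (td_sub_edge tD sD) eqxx in nDK.
have sK i A : subgraph A (F i) -> subgraph A (gbig F).
  by move/subgraph_trans; apply; apply: gbig_sub.
case: (td_split tD trF sD) => [[i sDi]|[F' [tF' sF' defD sh]]].
  case: (eqVneq D (F i)) => [eD|nD]; last first.
    have [A [B [x [y [z [tA tB sA sB tri3]]]]]] := IH i D tD sDi nD.
    by exists A, B, x, y, z; split; rewrite ?(sK i).
  have [j [l [nij nil njl]]] := ord3_others i; subst D.
  have [F2 F3] := trF; have [x ex] := F2 i j nij; have [y ey] := F2 j l njl.
  have [z ez] := F2 i l nil; exists (F j), (F l), x, y, z.
  split; rewrite ?gbig_sub //; split=> //.
  have [xi xj _] := (capP _ _ _).1 ex; have [yj yl _] := (capP _ _ _).1 ey.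
  have [zi zl _] := (capP _ _ _).1 ez.
  have no3 t : t \in gV (F i) -> t \in gV (F j) -> t \in gV (F l) -> False.
    move=> ti tj tl; have [m] := F3 t.
    by have [|->|->] := ord3_cover m nij nil njl; rewrite ?tj ?tl // => ->; rewrite ti.
  rewrite /= !inE negb_or !andbT; apply/andP; split; [apply/andP; split|];
    by apply/eqP=> e; subst; eauto.
have [i ni] : exists i, F' i != F i.
  case: (altP (@forallP _ (fun i => F' i == F i))) => [h|]; last first.
    by rewrite negb_forall => /existsP.
  by rewrite defD /gbig !(eqP (h _)) eqxx in nDK.
have [A [B [x [y [z [tA tB sA sB [eDA eAB eDB uq]]]]]]] := IH i (F' i) (tF' i) (sF' i) ni.
have cap E t : subgraph E (F i) -> gV (F' i) :&: gV E = [set t] -> gV D :&: gV E = [set t].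
  move=> sE /capP[tF'i tE u]; apply/capP; split=> //.
    by rewrite defD; apply/gbigV; exists i.
  by move=> a; rewrite defD => aD aE; apply: u => //;
    exact: (split_part sF' sh aD (subV sE aE)).
exists A, B, x, y, z; split; rewrite ?(sK i) //; split=> //;
  [exact: cap sA eDA | exact: cap sB eDB].
Qed.

Lemma td_spanning K D : td K -> td D -> subgraph D K -> gV D = gV K -> D = K.
Proof.
move=> tK tD sD eV; apply/eqP; apply: contraT => nDK.
have [A [B [x [y [z [tA tB sA sB [/capP[_ _ u] _ _ _]]]]]]] := td_extend tK tD sD nDK.
by have [a aA] := td_other x tA; case/eqP; rewrite (u a) ?eV ?(subV sA aA).
Qed.

(** By [td_join] the edge can be added to [D]; this leaves the vertex set unchanged, so by
    [td_spanning] the edge was there already. *)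
Lemma td_induced K D x y : td K -> td D -> subgraph D K -> x != y ->
  x \in gV D -> y \in gV D -> [set x; y] \in gE K -> [set x; y] \in gE D.
Proof.
move=> tK tD sD nxy xD yD /gedge_sub sE.
have tU : td (gunion D (gedge x y)).
  apply: (td_join tK tD (td_edge nxy) sD sE nxy xD yD); by rewrite !inE eqxx ?orbT.
rewrite (td_spanning tU tD (subgraph_unionl _ _)) //.
  by rewrite inE gE_gedge // inE eqxx orbT.
by apply/esym/setUidPl/subsetP => t; rewrite !inE => /orP[]/eqP->.
Qed.

(** The triples that extend [D] to its union with [R] extend [D'] as well, since intersections
    depend on vertex sets only. The condition on edges ensures that the enlarged [D'] contains [R]
    at the end. *)
Lemma td_replace D D' R : td D -> td D' -> gV D = gV D' -> td (gunion D R) ->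
  (forall e, e \in gE D -> e \in gE R -> e \in gE D') -> td (gunion D' R).
Proof.
(* Induction on the number of vertices outside [D]. *)
move: {2}_.+1 (ltnSn (#|~: gV D|)) => n.
elim: n => // n IHn in D D' *; rewrite ltnS => le_n tD tD' eV tDR sDR.
case: (eqVneq D (gunion D R)) => [e|nD].
  rewrite gunion_idr //; have sR : subgraph R D by rewrite e subgraph_unionr.
  apply/subgraphP; split=> a aR; first by rewrite -eV (subV sR).
  by apply: sDR; rewrite ?(subE sR).
have [A [B [x [y [z [tA tB sA sB tri3]]]]]] :=
  td_extend tDR tD (subgraph_unionl _ _) nD.
have tri3' : tri D' A B x y z by case: tri3 => *; split; rewrite -?eV.
have noE E t : gV D :&: gV E = [set t] -> forall e, e \in gE E -> e \notin gE D.
  move=> /capP[_ _ u] e; apply: edge_cap => a b aE bE aD bD.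
  by rewrite (u a aD aE) (u b bD bE).
have [eDA eAB eDB _] := tri3.
(* The edges of [E] are not in [D], hence are in [R], so [E] survives the replacement. *)
have sDR' E t : gV D :&: gV E = [set t] -> subgraph E (gunion D R) ->
    subgraph E (gunion D' R).
  move=> eDE /subgraphP[sV sE]; apply/subgraphP; split=> a aE.
    by move: (sV a aE); rewrite !inE eV.
  by move: (sE a aE); rewrite !inE (negPf (noE _ _ eDE a aE)) /= => ->; rewrite orbT.
have absorb E : subgraph A (gunion E R) -> subgraph B (gunion E R) ->
    gunion (gunion (gunion E A) B) R = gunion E R.
  move=> sAE sBE; rewrite gunionAC [gunion _ R]gunionAC.
  by rewrite [gunion (gunion E R) A]gunion_idr // gunion_idr.
rewrite -(absorb D') ?(sDR' _ _ eDA) ?(sDR' _ _ eDB) //.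
have [z' z'A z'x] := td_other x tA.
apply: (IHn (gunion (gunion D A) B)).
- apply: leq_trans le_n; apply: proper_card; apply/properP; split.
    by apply/subsetP => a; rewrite !inE !negb_or => /andP[/andP[->]].
  have [_ _ u] := (capP _ _ _).1 eDA.
  exists z'; rewrite !inE ?z'A ?orbT //; apply/negP=> z'D.
  by rewrite (u z' z'D z'A) eqxx in z'x.
- exact: td_tri tri3.
- exact: td_tri tri3'.
- by rewrite !gV_union eV.
- by rewrite absorb.
- move=> e; rewrite !inE => /orP[/orP[eD /(sDR e eD)->//|->]|->]; rewrite ?orbT //.
Qed.

(** * Clusters as maximal td subgraphs *)

Lemma cluster_eq G A B : cluster G A -> td B -> subgraph B G -> subgraph A B -> A = B.
Proof. by case=> _ _ mx tB sB sAB; rewrite (mx B). Qed.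

Lemma cluster_unique K H A B x y : td K -> subgraph H K ->
  cluster H A -> cluster H B -> x != y ->
  x \in gV A -> y \in gV A -> x \in gV B -> y \in gV B -> A = B.
Proof.
move=> tK sHK cA cB nxy xA yA xB yB; have [sA tA _] := cA; have [sB tB _] := cB.
have tAB : td (gunion A B).
  by apply: (td_join tK tA tB _ _ nxy); rewrite ?(subgraph_trans _ sHK).
have sAB : subgraph (gunion A B) H by rewrite gunion_sub sA sB.
rewrite (cluster_eq cA tAB sAB (subgraph_unionl A B)).
by rewrite -(cluster_eq cB tAB sAB (subgraph_unionr A B)).
Qed.

Lemma cluster_cap K H A B x : td K -> subgraph H K ->
  cluster H A -> cluster H B -> A != B -> x \in gV A -> x \in gV B ->
  gV A :&: gV B = [set x].
Proof.
move=> tK sHK cA cB nAB xA xB; apply/capP; split=> // a aA aB.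
apply/eqP; apply: contraNT nAB => nax; apply/eqP.
exact: cluster_unique tK sHK cA cB nax aA xA aB xB.
Qed.

(** The union of the triple would be a td subgraph strictly larger than [A]. *)
Lemma cluster_no_tri H A B C x y z : cluster H A -> td B -> td C ->
  subgraph B H -> subgraph C H -> ~ tri A B C x y z.
Proof.
move=> cA tB tC sB sC tABC; have [sA tA _] := cA.
have e : A = gunion (gunion A B) C.
  apply: cluster_eq cA (td_tri tA tB tC tABC) _ _.
    by rewrite !gunion_sub sA sB sC.
  by rewrite -gunionA subgraph_unionl.
have [eAB _ _ _] := tABC; have := td_cap_not_sub tB eAB.
by rewrite [X in subgraph _ X]e gunionAC subgraph_unionr.
Qed.

Lemma cluster_above H A : td A -> subgraph A H ->
  exists2 C, cluster H C & subgraph A C.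
Proof.
move: {2}_.+1 (ltnSn #|[set D | subgraph A D]|) => n.
elim: n A => // n IHn A; rewrite ltnS => le_n tA sA.
case: (classic (exists D, [/\ td D, subgraph D H, subgraph A D & D != A])).
  move=> [D [tD sD sAD nDA]].
  have [|C cC sDC] := IHn D _ tD sD; last by exists C => //; apply: subgraph_trans sAD sDC.
  apply: leq_trans le_n; apply: proper_card; apply/properP; split.
    by apply/subsetP=> E; rewrite !inE; apply: subgraph_trans.
  exists A; rewrite !inE ?subgraph_refl //; apply: contra nDA => sDA.
  by rewrite (subgraph_anti sDA sAD).
move=> nD; exists A; rewrite ?subgraph_refl //; split=> // D sD tD sAD.
by apply/eqP; apply: contra_notT nD => nDA; exists D.
Qed.

Lemma cluster_sub H H' A : subgraph H H' -> cluster H' A -> subgraph A H ->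
  cluster H A.
Proof.
move=> sH [_ tA mx] sA; split=> // D sD; apply: mx.
exact: subgraph_trans sD sH.
Qed.

Lemma gV_add_edge G x y : x \in gV G -> y \in gV G -> gV (add_edge G (x, y)) = gV G.
Proof. by move=> xG yG; apply/setUidPl/subsetP=> t; rewrite !inE => /orP[]/eqP->. Qed.

Lemma gE_add_edge G x y e : e \in gE (add_edge G (x, y)) ->
  e \in gE G \/ e = [set x; y].
Proof. by rewrite !inE => /orP[->|/andP[/eqP->]]; [left|right]. Qed.

Lemma sub_add_edge H X x y : x \in gV H -> y \in gV H ->
  subgraph X (add_edge H (x, y)) -> [set x; y] \notin gE X -> subgraph X H.
Proof.
move=> xH yH /subgraphP[sV sE] nE; apply/subgraphP; split=> a aX.
  by rewrite -(gV_add_edge xH yH) sV.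
by have [//|e] := gE_add_edge (sE a aX); rewrite e (negPf nE) in aX.
Qed.

(** * Four-cycles of clusters *)

Definition cyc A B C D x y z t : Prop :=
  [/\ gV A :&: gV B = [set x], gV B :&: gV C = [set y], gV C :&: gV D = [set z],
      gV D :&: gV A = [set t] & uniq [:: x; y; z; t]].

Lemma cyc_rot A B C D x y z t : cyc A B C D x y z t -> cyc B C D A y z t x.
Proof. by case=> *; split=> //; rewrite -(rot_uniq 3). Qed.

Lemma cyc_rev A B C D x y z t : cyc A B C D x y z t -> cyc A D C B t z y x.
Proof.
by case=> *; split; rewrite 1?[gV A :&: _]setIC 1?[gV D :&: gV C]setIC
  1?[gV C :&: gV B]setIC 1?[gV B :&: gV A]setIC // -rev_uniq.
Qed.

(** A common vertex of [A] and [C] would close a triangle [A], [B], [C], which [cluster_no_tri]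
    forbids. *)
Lemma cyc_opposite K H A B C D x y z t v : td K -> subgraph H K ->
  cluster H A -> cluster H B -> cluster H C -> cyc A B C D x y z t ->
  v \in gV A -> v \in gV C -> False.
Proof.
move=> tK sHK cA cB cC [/capP[xA xB uAB] /capP[yB yC uBC] _ _ uq] vA vC.
have nxy : x != y by move: uq; rewrite /= !inE !negb_or => /andP[/andP[]].
have nAC : A != C.
  by apply: contra nxy => /eqP e; apply/eqP/esym/uAB; rewrite // e.
have eAC := cluster_cap tK sHK cA cC nAC vA vC.
have [sB tB _] := cB; have [sC tC _] := cC.
apply: (cluster_no_tri (x := x) (y := y) (z := v) cA tB tC sB sC).
split; [exact/capP|exact/capP|exact: eAC|].
rewrite /= !inE negb_or nxy andbT; apply/andP; split.
  by apply: contra nxy => /eqP e; rewrite (uBC x) // e.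
by apply: contra nxy => /eqP e; rewrite eq_sym (uAB y) // e.
Qed.

Definition gunion4 A B C D := gunion (gunion A B) (gunion C D).

Lemma gunion4_rot A B C D : gunion4 A B C D = gunion4 B C D A.
Proof.
by apply: graph_eq; apply/setP=> a; rewrite !inE; do !case: (a \in _).
Qed.

Lemma gunion4_rev A B C D : gunion4 A B C D = gunion4 A D C B.
Proof.
by apply: graph_eq; apply/setP=> a; rewrite !inE; do !case: (a \in _).
Qed.

(** The edge [uw] forms a triangle with [A] and [B], and the union of these forms a second triangle
    with [C] and [D]. Opposite clusters are disjoint, so no further vertices are shared. *)
Lemma cyc_td K H A B C D x y z t u w : td K -> subgraph H K ->
  cluster H A -> cluster H B -> cluster H C -> cluster H D ->
  cyc A B C D x y z t ->
  u \in gV A -> u \notin gV B -> w \in gV B -> w \notin gV A ->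
  td (add_edge (gunion4 A B C D) (u, w)).
Proof.
move=> tK sHK cA cB cC cD cy uA uB wB wA.
have opAC v := cyc_opposite (v := v) tK sHK cA cB cC cy.
have opBD v := cyc_opposite (v := v) tK sHK cB cC cD (cyc_rot cy).
have [eAB eBC eCD eDA uq] := cy.
have [xA xB uAB] := (capP _ _ _).1 eAB; have [yB yC uBC] := (capP _ _ _).1 eBC.
have [tD tA' uDA] := (capP _ _ _).1 eDA.
have [_ tA _] := cA; have [_ tB _] := cB; have [_ tC _] := cC; have [_ tD' _] := cD.
have nuw : u != w by apply: contraNneq uB => ->.
have triE : tri (gedge u w) A B u x w.
  split; [apply/capP|by []|apply/capP|].
  - split=> [||a]; rewrite ?inE ?eqxx //.
    by move=> /orP[]/eqP-> //; rewrite (negPf wA).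
  - split=> [||a]; rewrite ?inE ?eqxx ?orbT //.
    by move=> /orP[]/eqP-> //; rewrite (negPf uB).
  rewrite /= !inE negb_or nuw !andbT; apply/andP; split.
    by apply: contraNneq uB => ->.
  by apply: contraNneq wA => <-.
have tM := td_tri (td_edge nuw) tA tB triE.
have triM : tri (gunion (gunion (gedge u w) A) B) C D y z t.
  split; [apply/capP|by []|apply/capP|].
  - split; rewrite ?inE ?yB ?orbT // => a; rewrite !inE -orbA.
    case/or3P=> [/pred2P[]->|aA|aB] aC; [by case: (opAC u)|exact: uBC| |exact: uBC].
    by case: (opAC a).
  - split; rewrite ?inE ?tA' ?orbT // => a; rewrite !inE -orbA.
    case/or3P=> [/pred2P[]->|aA|aB] aD; [exact: uDA|by case: (opBD w)|exact: uDA|].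
    by case: (opBD a).
  by move: uq; rewrite [uniq _]/= [uniq [:: y; _; _]]/= => /andP[_].
have := td_tri tM tC tD' triM; congr td.
by rewrite /add_edge /gunion4 [RHS]gunionC !gunionA.
Qed.

(** Opposite clusters are disjoint, so adjacent ones are consecutive, and a rotation or reflection
    puts them first. *)
Lemma adjacent_cyc K H (S : {set graph T}) A B : td K -> subgraph H K ->
  four_cycle_of_clusters H S -> adjacent S A B ->
  exists C D x y z t, cyc A B C D x y z t /\
    [/\ cluster H A, cluster H B, cluster H C & cluster H D].
Proof.
move=> tK sHK [[_ [A0 [B0 [C0 [D0 [defS [x [y [z [t cy]]]]]]]]]] cS] [AS BS nAB mAB].
have [cA cB cC cD] : [/\ cluster H A0, cluster H B0, cluster H C0 & cluster H D0].
  by split; apply: cS; rewrite defS !inE eqxx ?orbT.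
have cy1 := cyc_rot cy; have cy2 := cyc_rot cy1; have cy3 := cyc_rot cy2.
have opp P Q R U x' y' z' t' : cluster H P -> cluster H Q -> cluster H R ->
    cyc P Q R U x' y' z' t' -> gV P :&: gV R != set0 -> False.
  move=> cP cQ cR cPQ /set0Pn[v]; rewrite inE => /andP[vP vR].
  exact: cyc_opposite tK sHK cP cQ cR cPQ vP vR.
have build P Q R U x' y' z' t' : cluster H P -> cluster H Q -> cluster H R ->
    cluster H U -> cyc P Q R U x' y' z' t' ->
    exists C D x y z t, cyc P Q C D x y z t /\
      [/\ cluster H P, cluster H Q, cluster H C & cluster H D].
  by move=> cP cQ cR cU cPQ; exists R, U, x', y', z', t'.
(* Of the sixteen positions, four have [A = B], four are opposite pairs, and eight are the rotations
   and reflections. *)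
move: AS BS; rewrite defS !inE -!orbA => /or4P[] /eqP eA /or4P[] /eqP eB; subst A B;
  rewrite ?eqxx // in nAB *;
  first [ by case: (opp _ _ _ _ _ _ _ _ _ _ _ cy) | by case: (opp _ _ _ _ _ _ _ _ _ _ _ cy1)
        | by case: (opp _ _ _ _ _ _ _ _ _ _ _ cy2) | by case: (opp _ _ _ _ _ _ _ _ _ _ _ cy3)
        | by apply: build cy | by apply: build cy1 | by apply: build cy2
        | by apply: build cy3 | by apply: build (cyc_rev cy)
        | by apply: build (cyc_rev cy1) | by apply: build (cyc_rev cy2)
        | by apply: build (cyc_rev cy3)].
Qed.

Lemma cards_set4 (S : finType) (a b c d : S) :
  a != b -> c != a -> d != a -> c != b -> d != b -> c != d ->
  #|[set a; b; c; d]| = 4.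
Proof.
move=> nab nca nda ncb ndb ncd; have /card_uniqP eS : uniq [:: a; b; c; d].
  rewrite /= !inE !negb_or nab ncd ![a == _]eq_sym ![b == _]eq_sym.
  by rewrite nca nda ncb ndb.
by rewrite -[RHS]eS; apply: eq_card => e; rewrite !inE -!orbA.
Qed.

Lemma adjacent_dichotomy H u w C0 : u != w -> [set u; w] \notin gE H ->
  u \in gV H -> w \in gV H -> td (add_edge H (u, w)) ->
  td C0 -> subgraph C0 H ->
  (exists A B, [/\ td A, td B, subgraph A H, subgraph B H &
     forall C, td C -> subgraph C H -> subgraph C A \/ subgraph C B]) \/
  exists2 S : {set graph T}, four_cycle_of_clusters H S & in_adjacent_pair S u w.
Proof.
move=> nuw nE uH wH tK tC0 sC0; pose K := add_edge H (u, w); pose E := gedge u w.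
have sHK : subgraph H K := subgraph_unionl _ _.
have sEK : subgraph E K := subgraph_unionr _ _.
have notE X : subgraph X H -> [set u; w] \notin gE X.
  by move=> sX; apply: contra nE; apply: subE.
have Enotsub X : td X -> subgraph X H -> ~ subgraph X E.
  move=> tX sX sXE; have := notE X sX; rewrite (td_sub_edge tX sXE) gE_gedge //.
  by rewrite inE eqxx.
(* By [td_induced] such an [X] would contain the edge [uw]. *)
have notuw X : td X -> subgraph X H -> u \in gV X -> w \in gV X -> False.
  move=> tX sX uX wX; have /negP := notE X sX; apply.
  apply: (td_induced tK tX (subgraph_trans sX sHK) nuw uX wX).
  by apply: (subE sEK); rewrite gE_gedge // inE.
(* A graph meeting [D] in one vertex cannot contain both ends of [uw], so it lies in [H]. *)
have inH D X t : subgraph E D -> subgraph X K -> gV D :&: gV X = [set t] -> subgraph X H.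
  move=> sED sXK /capP[_ _ uq]; apply: (sub_add_edge uH wH sXK).
  apply/negP=> /edgeP[_ /subsetP s].
  have e v : v \in [set u; w] -> v = t.
    by move=> vE; apply: uq; [apply: (subV sED) | apply: s].
  by case/eqP: nuw; rewrite (e u (set21 u w)) (e w (set22 u w)).
have nEK : E != K.
  apply/eqP => eEK; apply: (Enotsub _ tC0 sC0); rewrite eEK.
  exact: subgraph_trans sC0 sHK.
have [A [B [x [y [z [tA tB sA sB [eEA eAB eEB uq]]]]]]] :=
  td_extend tK (td_edge nuw) sEK nEK.
have {sA} sA := inH _ _ _ (subgraph_refl _) sA eEA.
have {sB} sB := inH _ _ _ (subgraph_refl _) sB eEB.
have [xE xA _] := (capP _ _ _).1 eEA; have [zE zB _] := (capP _ _ _).1 eEB.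
have [yA yB _] := (capP _ _ _).1 eAB.
have nxz : x != z by move: uq; rewrite /= !inE negb_or => /andP[/andP[]].
have euw : [set u; w] = [set x; z].
  move: xE zE nxz; rewrite !inE => /pred2P[]-> /pred2P[]->; rewrite ?eqxx // => _.
  by rewrite setUC.
have notxz X : td X -> subgraph X H -> x \in gV X -> z \in gV X -> False.
  move=> tX sX xX zX; apply: (notuw X tX sX); move/setP: euw => euw.
    by have := euw u; rewrite !inE eqxx /= => /esym/pred2P[]->.
  by have := euw w; rewrite !inE eqxx orbT /= => /esym/pred2P[]->.
have [A' cA sAA] := cluster_above tA sA; have [B' cB sBB] := cluster_above tB sB.
have [sA' tA' _] := cA; have [sB' tB' _] := cB.
have xA' := subV sAA xA; have zB' := subV sBB zB.
have yA' := subV sAA yA; have yB' := subV sBB yB.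
have zA' : z \notin gV A' by apply/negP => zA'; apply: (notxz A').
have xB' : x \notin gV B' by apply/negP => xB'; apply: (notxz B').
have nAB : A' != B' by apply: contraNneq zA' => ->.
have eAB' := cluster_cap tK sHK cA cB nAB yA' yB'.
have inE0 v : v \in gV E -> v = x \/ v = z.
  by rewrite /E /gV /= euw => /set2P.
have triE : tri E A' B' x y z.
  split=> //; apply/capP; split=> // v /inE0[->|->] //; last by rewrite (negPf xB').
  by rewrite (negPf zA').
pose D := gunion (gunion E A') B'.
have tD : td D := td_tri (td_edge nuw) tA' tB' triE.
have sD : subgraph D K by rewrite !gunion_sub sEK !(subgraph_trans _ sHK).
have inD v : v \in gV D -> v \in gV A' \/ v \in gV B'.
  by rewrite !inE -orbA => /or3P[|->|->]; auto; rewrite -in_set2 => /inE0[->|->]; auto.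
have sED : subgraph E D by rewrite /D -gunionA subgraph_unionl.
have sAD : subgraph A' D by rewrite /D gunionAC subgraph_unionr.
have sBD : subgraph B' D by rewrite /D subgraph_unionr.
case: (eqVneq D K) => [eDK|nDK].
  left; exists A', B'; split=> // C tC sC.
  have sCF : subgraph C (gbig (fam E A' B')).
    by rewrite gbig_fam -/D eDK (subgraph_trans sC).
  have [[i]|sp] := td_split tC (triangle_fam triE) sCF.
    case: i => -[|[|[|//]]] /= hi; rewrite /fam /=; try by auto.
    by move/(Enotsub C tC sC).
  case: (notxz C tC sC).
    apply: (split_mem (i := ord0) (j := inord 1) sp); rewrite /fam /= ?inordK //.
    by rewrite -val_eqE /= inordK.
  apply: (split_mem (i := ord0) (j := inord 2) sp); rewrite /fam /= ?inordK //.
  by rewrite -val_eqE /= inordK.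
right; have [A2 [B2 [p [q [r [tA2 tB2 sA2 sB2 tri2]]]]]] := td_extend tK tD sD nDK.
(* If [p] and [r] lay in one cluster, the second triple would enlarge it; so they are distributed
   over [A'] and [B'], and [A2], [B2] can be named accordingly. *)
wlog pA : A2 B2 p q r tA2 tB2 sA2 sB2 tri2 / p \in gV A' /\ r \in gV B'.
  move=> wl; have [eDA eA2 eDB uq2] := tri2.
  have sA2H := inH _ _ _ sED sA2 eDA; have sB2H := inH _ _ _ sED sB2 eDB.
  have noboth X : cluster H X -> subgraph X D -> p \in gV X -> r \in gV X -> False.
    move=> cX sXD pX rX; apply: (cluster_no_tri cX tA2 tB2 sA2H sB2H (x := p) (y := q) (z := r)).
    split=> //; apply/capP; split=> //; move: eDA eDB => /capP[_ pA2 u1] /capP[_ rB2 u2] //.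
      by move=> v /(subV sXD); apply: u1.
    by move=> v /(subV sXD); apply: u2.
  have [pD _ _] := (capP _ _ _).1 eDA; have [rD _ _] := (capP _ _ _).1 eDB.
  have tri2' : tri D B2 A2 r q p.
    by split; rewrite // 1?setIC // -rev_uniq; exact: uq2.
  case: (inD p pD) => pX; case: (inD r rD) => rX.
  - by case: (noboth A').
  - by apply: (wl A2 B2 p q r).
  - by apply: (wl B2 A2 r q p).
  - by case: (noboth B').
have [eDA eA2 eDB uq2] := tri2; case: pA => pA rB.
have sA2H := inH _ _ _ sED sA2 eDA; have sB2H := inH _ _ _ sED sB2 eDB.
have [pD pA2 uDA] := (capP _ _ _).1 eDA; have [rD rB2 uDB] := (capP _ _ _).1 eDB.
have [qA2 qB2 uA2] := (capP _ _ _).1 eA2.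
have [npq npr nqr] : [/\ p != q, p != r & q != r].
  by move: uq2; rewrite /= !inE negb_or andbT => /andP[/andP[]].
have noboth X : cluster H X -> subgraph X D -> p \in gV X -> r \in gV X -> False.
  move=> cX sXD pX rX; apply: (cluster_no_tri cX tA2 tB2 sA2H sB2H (x := p) (y := q) (z := r)).
  split=> //; apply/capP; split=> //.
    by move=> v /(subV sXD); apply: uDA.
  by move=> v /(subV sXD); apply: uDB.
have rA : r \notin gV A' by apply/negP => rA; apply: (noboth A').
have pB : p \notin gV B' by apply/negP => pB; apply: (noboth B').
have [A3 cA3 sA3] := cluster_above tA2 sA2H; have [B3 cB3 sB3] := cluster_above tB2 sB2H.
have [sA3' tA3 _] := cA3; have [sB3' tB3 _] := cB3.
have nsub X Y t : td X -> subgraph X Y -> gV D :&: gV X = [set t] -> subgraph Y D -> False.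
  move=> tX sXY eDX sYD; have /negP := td_cap_not_sub tX eDX; apply.
  exact: subgraph_trans sXY sYD.
have nA3A : A3 != A' by apply/eqP => e; apply: (nsub A2 A3 p); rewrite // e.
have nA3B : A3 != B' by apply/eqP => e; apply: (nsub A2 A3 p); rewrite // e.
have nB3A : B3 != A' by apply/eqP => e; apply: (nsub B2 B3 r); rewrite // e.
have nB3B : B3 != B' by apply/eqP => e; apply: (nsub B2 B3 r); rewrite // e.
have eA3A := cluster_cap tK sHK cA3 cA nA3A (subV sA3 pA2) pA.
have rB3 := subV sB3 rB2.
have eBB3 : gV B' :&: gV B3 = [set r].
  by rewrite setIC (cluster_cap tK sHK cB3 cB nB3B rB3 rB).
have nyr : y != r by apply: contraNneq rA => <-.
have nyp : y != p by apply: contraNneq pB => <-.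
have nyq : y != q.
  apply: contraNneq npq => eyq; apply/eqP/esym/uDA => //; rewrite -eyq.
  exact: (subV sAD yA').
(* A single cluster containing both new graphs would form a triangle with [A'] and [B']. *)
have nAB3 : B3 != A3.
  apply/eqP => e; apply: (cluster_no_tri cA tB' tA3 sB' sA3' (x := y) (y := r) (z := p)).
  split=> //; [by rewrite -e | by rewrite setIC |].
  by rewrite /= !inE negb_or nyr nyp eq_sym npr.
have eBA3 := cluster_cap tK sHK cB3 cA3 nAB3 (subV sB3 qB2) (subV sA3 qA2).
exists [set A'; B'; B3; A3].
  split; last by move=> C; rewrite !inE -!orbA => /or4P[]/eqP->.
  split.
    exact: cards_set4 nAB nB3A nA3A nB3B nA3B nAB3.
  exists A', B', B3, A3; split=> //; exists y, r, q, p; split=> //.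
  by rewrite /= !inE !negb_or nyr nyq nyp eq_sym nqr eq_sym npr eq_sym npq.
exists A', B'; split.
  split; rewrite ?inE ?eqxx ?orbT //; apply/set0Pn; exists y; by rewrite inE yA'.
by rewrite euw; apply/subsetP => v; rewrite !inE => /pred2P[]->; rewrite ?xA' ?zB' ?orbT.
Qed.

(** * A single construction step *)

Lemma step_facts G H (st : step T) : valid_step G H st ->
  [/\ step_u st \in gV H, step_w st \in gV H, step_vertex st \notin gV H &
    uniq [:: step_u st; step_vertex st; step_w st]].
Proof.
case=> _ /capP[vT vT' _] /capP[uT uH uqT] /capP[wT wH uqT'] nuw.
(* A step vertex inside [H] would equal both attachment vertices, which differ. *)
have nvu : step_vertex st \notin gV H.
  apply/negP=> vH; case/eqP: nuw.
  by rewrite -(uqT _ vT vH) (uqT' _ vT' vH).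
split=> //; rewrite /= !inE negb_or nuw !andbT; apply/andP; split.
  by apply: contraNneq nvu => <-.
by apply: contraNneq nvu => ->.
Qed.

(** Such an [X] would close a triangle with the two new clusters, against their maximality. *)
Lemma step_not_both G H (st : step T) X : valid_step G H st -> td X ->
  subgraph X G -> {subset gV X <= gV H} ->
  step_u st \in gV X -> step_w st \in gV X -> False.
Proof.
move=> vst tX sXG sXH uX wX; have [uH wH vH uq] := step_facts vst.
have [[cT cT'] eTT /capP[uT _ uqT] /capP[wT _ uqT'] nuw] := vst.
have [sT' tT' _] := cT'.
apply: (cluster_no_tri cT tT' tX sT' sXG
  (x := step_vertex st) (y := step_w st) (z := step_u st)).
split=> //; [apply/capP|apply/capP|].
- by split=> // a aT /sXH; apply: uqT'.
- by split=> // a aT /sXH; apply: uqT.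
by move: uq; rewrite -(rot_uniq 1).
Qed.

Lemma step_no_edge G H (st : step T) : valid_step G H st ->
  [set step_u st; step_w st] \notin gE G.
Proof.
move=> vst; apply/negP=> eG; have [_ _ _ _ nuw] := vst.
have [uH wH _ _] := step_facts vst.
apply: (step_not_both vst (td_edge nuw) (gedge_sub eG)).
- by move=> a; rewrite !inE => /pred2P[]->.
- by rewrite !inE eqxx.
by rewrite !inE eqxx orbT.
Qed.

Lemma step_tri G H (st : step T) K : valid_step G H st -> gV K = gV H ->
  tri K (step_T st) (step_T' st) (step_u st) (step_vertex st) (step_w st).
Proof.
move=> vst eV; have [_ _ _ uq] := step_facts vst.
by case: vst => _ *; split; rewrite ?eV // setIC.
Qed.

(** The two new clusters form a triangle with [H] plus [xy]. This carries base edges and extreme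
    edges alike to later stages. *)
Lemma step_extend G H (st : step T) x y : valid_step G H st ->
  x \in gV H -> y \in gV H -> td (add_edge H (x, y)) ->
  td (add_edge (append_step H st) (x, y)).
Proof.
move=> vst xH yH tK; have [[[_ tT _] [_ tT' _]] _ _ _ _] := vst.
have := td_tri tK tT tT' (step_tri vst (gV_add_edge xH yH)).
by congr td; rewrite /add_edge /append_step 
  [RHS]gunionAC [gunion (gunion H (step_T st)) _]gunionAC.
Qed.

(** Apply [td_split] to the triangle of [H] plus [xy] and the two new clusters. If [C] were split,
    its first piece would contain both attachment vertices, which [step_not_both] excludes. *)
Lemma cluster_append G H (st : step T) x y C : valid_step G H st ->
  subgraph (append_step H st) G -> x \in gV H -> y \in gV H ->
  [set x; y] \notin gE G -> td (add_edge H (x, y)) ->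
  cluster (append_step H st) C ->
  [\/ subgraph C H, C = step_T st | C = step_T' st].
Proof.
move=> vst sG xH yH nE tK cC; have [[cT cT'] _ _ _ _] := vst.
have [sC tC _] := cC; have [_ tT _] := cT; have [_ tT' _] := cT'.
have sCG := subgraph_trans sC sG.
pose K := add_edge H (x, y); have eV : gV K = gV H := gV_add_edge xH yH.
have trF := step_tri vst eV.
have sTH : subgraph (step_T st) (append_step H st).
  by rewrite /append_step gunionAC subgraph_unionr.
have sTH' : subgraph (step_T' st) (append_step H st) := subgraph_unionr _ _.
have nEX X : subgraph X G -> [set x; y] \notin gE X.
  by move=> sX; apply: contra nE; apply: subE.
have sCF : subgraph C (gbig (fam K (step_T st) (step_T' st))).
  apply: subgraph_trans sC _; rewrite gbig_fam !gunion_sub -gunionA.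
  rewrite (subgraph_trans (subgraph_unionl H (gedge x y)) (subgraph_unionl _ _)) /=.
  by rewrite gunionA subgraph_unionr gunionAC subgraph_unionr.
have [[i]|[F' [tF' sF' defC sh]]] := td_split tC (triangle_fam trF) sCF.
  case: i => -[|[|[|//]]] /= hi; rewrite /fam /= => sCi.
  - by constructor 1; apply: sub_add_edge sCi (nEX C sCG).
  - by constructor 2; apply: cluster_eq cC tT sTH sCi.
  - by constructor 3; apply: cluster_eq cC tT' sTH' sCi.
have n01 : ord0 != inord 1 :> 'I_3 by rewrite -val_eqE /= inordK.
have n02 : ord0 != inord 2 :> 'I_3 by rewrite -val_eqE /= inordK.
have [/capP[uK uT _] _ /capP[wK wT' _] _] := trF.
case: (step_not_both vst (tF' ord0)).
- by apply: subgraph_trans sCG; rewrite defC gbig_sub.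
- by move=> a /(subV (sF' ord0)); rewrite /fam /= eV.
- by apply: (sh _ (inord 1) _ n01); rewrite /fam /= ?inordK.
- by apply: (sh _ (inord 2) _ n02); rewrite /fam /= ?inordK.
Qed.

(** The two new clusters play symmetric roles; exchanging them saves half of the cases for
    four-cycles. *)
Definition swap_step (st : step T) : step T :=
  Step (step_vertex st) (step_w st) (step_u st) (step_T' st) (step_T st).

Lemma append_swap H (st : step T) : append_step H (swap_step st) = append_step H st.
Proof. by rewrite /append_step /= gunionAC. Qed.

Lemma valid_swap G H (st : step T) : valid_step G H st -> valid_step G H (swap_step st).
Proof. by case=> -[cT cT'] *; split=> //=; rewrite 1?setIC 1?eq_sym. Qed.

(** The cluster [step_T st] meets [H] in one vertex only, but its neighbours in the cycle meet it in
    two; so one neighbour is [step_T' st]. The other two clusters lie in [H], are adjacent and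
    contain one attachment vertex each, so [cyc_td] applies to them. *)
Lemma cyc_new_cluster G H (st : step T) x y A B C D a b c d : valid_step G H st ->
  subgraph (append_step H st) G -> x \in gV H -> y \in gV H ->
  [set x; y] \notin gE G -> td (add_edge H (x, y)) ->
  cyc A B C D a b c d ->
  cluster (append_step H st) A -> cluster (append_step H st) B ->
  cluster (append_step H st) C -> cluster (append_step H st) D ->
  A = step_T st ->
  [/\ step_u st \in gV (gunion4 A B C D), step_w st \in gV (gunion4 A B C D) &
    td (add_edge (gunion4 A B C D) (step_u st, step_w st))].
Proof.
move=> vst sG xH yH nE tK cy cA cB cC cD eA.
have kind X : cluster (append_step H st) X ->
  [\/ subgraph X H, X = step_T st | X = step_T' st] := cluster_append vst sG xH yH nE tK.
pose K := add_edge (append_step H st) (x, y).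
have tK' : td K := step_extend vst xH yH tK.
have sK : subgraph (append_step H st) K := subgraph_unionl _ _.
have [uH wH _ uq] := step_facts vst.
have [[cT cT'] eTT /capP[uT _ uqT] /capP[wT' _ uqT'] _] := vst.
have neq X Y t : cluster (append_step H st) Y -> gV X :&: gV Y = [set t] -> X <> Y.
  move=> [_ tY _] eXY e; have := td_cap_not_sub tY eXY.
  by rewrite e subgraph_refl.
wlog eB : B D a b c d cy cB cD / B = step_T' st.
  move=> wl; have [eAB eBC eCD eDA uqc] := cy.
  case: (kind B cB) => [sB|eB|eB].
  - case: (kind D cD) => [sD|eD|eD].
    + have [aA aB _] := (capP _ _ _).1 eAB; have [dD dA _] := (capP _ _ _).1 eDA.
      move: uqc; rewrite eA in aA dA.
      by rewrite (uqT a aA (subV sB aB)) (uqT d dA (subV sD dD)) /= !inE eqxx !orbT.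
    + by case: (neq _ _ _ cA eDA); rewrite eD.
    + by rewrite gunion4_rev; apply: wl (cyc_rev cy) cD cB eD.
  - by case: (neq _ _ _ cB eAB); rewrite eB.
  - exact: wl cy cB cD eB.
have [eAB eBC eCD eDA uqc] := cy.
have opAC v := cyc_opposite (v := v) tK' sK cA cB cC cy.
have opBD v := cyc_opposite (v := v) tK' sK cB cC cD (cyc_rot cy).
have [aA aB _] := (capP _ _ _).1 eAB; have [bB bC uBC] := (capP _ _ _).1 eBC.
have [dD dA _] := (capP _ _ _).1 eDA; have [cC' cD' uCD] := (capP _ _ _).1 eCD.
have sC : subgraph C H.
  case: (kind C cC) => [//|eC|eC]; first by case: (opAC a); rewrite // eC -eA.
  by case: (neq _ _ _ cC eBC); rewrite eB eC.
have sD : subgraph D H.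
  case: (kind D cD) => [//|eD|eD]; first by case: (neq _ _ _ cA eDA); rewrite eD.
  by case: (opBD a); rewrite // eD -eB.
have eu : d = step_u st by apply: uqT; [rewrite -eA | apply: subV sD _ dD].
have ew : b = step_w st by apply: uqT'; [rewrite -eB | apply: subV sC _ bC].
have [nbc ncd] : b != c /\ c != d.
  by move: uqc; rewrite /= !inE !negb_or => /and4P[_ /andP[-> _] ->].
rewrite -eu -ew; split; try by rewrite !inE ?dD ?bC ?orbT.
have cyD : cyc D C B A c b a d.
  by split; rewrite 1?setIC // -(rot_uniq 3) -rev_uniq; exact: uqc.
have dC : d \notin gV C by apply: contra ncd => dC; rewrite (uCD d dC dD).
have bD : b \notin gV D by apply: contra nbc => bD; rewrite (uCD b bC bD).
by rewrite -gunion4_rot -gunion4_rev; apply: cyc_td tK' sK cD cC cB cA cyD dD dC bC bD.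
Qed.

(** A cycle inside [H] is covered by the assumption on [H] and [step_extend]. Otherwise a new
    cluster occurs, and the union [Q] of the cycle becomes td with [uw] as well as with the pair of
    the step, so the two can be exchanged. *)
Lemma append_four_cycle G H (st : step T) x y A B C D a b c d u w : valid_step G H st ->
  subgraph (append_step H st) G -> x \in gV H -> y \in gV H ->
  [set x; y] \notin gE G -> td (add_edge H (x, y)) ->
  td (add_edge H (step_u st, step_w st)) ->
  (forall A B C D a b c d, cyc A B C D a b c d ->
     cluster H A -> cluster H B -> cluster H C -> cluster H D ->
     u \in gV A -> u \notin gV B -> w \in gV B -> w \notin gV A ->
     td (add_edge H (u, w))) ->
  cyc A B C D a b c d ->
  cluster (append_step H st) A -> cluster (append_step H st) B ->
  cluster (append_step H st) C -> cluster (append_step H st) D ->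
  u \in gV A -> u \notin gV B -> w \in gV B -> w \notin gV A ->
  td (add_edge (append_step H st) (u, w)).
Proof.
move=> vst sG xH yH nE tK tuw IH cy cA cB cC cD uA uB wB wA.
pose H' := append_step H st.
have kind X : cluster H' X ->
  [\/ subgraph X H, X = step_T st | X = step_T' st] := cluster_append vst sG xH yH nE tK.
have tK' : td (add_edge H' (x, y)) := step_extend vst xH yH tK.
have sK : subgraph H' (add_edge H' (x, y)) := subgraph_unionl _ _.
have [uH wH _ uq] := step_facts vst.
pose Q := gunion4 A B C D.
have sQ : subgraph Q H'.
  by case: cA cB cC cD => sA _ _ [sB _ _] [sC _ _] [sD _ _]; rewrite !gunion_sub sA sB sC.
(* The exchange by [td_replace] takes place in the extreme graph with the two new clusters
   appended. *)
have swap : [/\ step_u st \in gV Q, step_w st \in gV Q &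
    td (add_edge Q (step_u st, step_w st))] -> td (add_edge H' (u, w)).
  case=> uQ wQ tQ.
  have tQuw : td (add_edge Q (u, w)).
    exact: cyc_td tK' sK cA cB cC cD cy uA uB wB wA.
  have absorb e : gunion (add_edge Q e) H' = add_edge H' e.
    by rewrite /add_edge gunionC gunionA [gunion H' Q]gunion_idr.
  rewrite -absorb; apply: (td_replace tQ tQuw).
  - by rewrite !gV_add_edge // !inE ?uA ?wB ?orbT.
  - by rewrite absorb; apply: step_extend vst uH wH tuw.
  (* The only edge that the exchange could lose is the pair of the step, a nonedge of [G]. *)
  move=> e /gE_add_edge[eQ _|->]; first by rewrite inE eQ.
  by move/(subE sG); rewrite (negPf (step_no_edge vst)).
have swapT' : [/\ step_w st \in gV Q, step_u st \in gV Q &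
    td (add_edge Q (step_w st, step_u st))] -> td (add_edge H' (u, w)).
  by case=> wQ uQ; rewrite /add_edge gedgeC => tQ; apply: swap.
have new := cyc_new_cluster vst sG xH yH nE tK.
have vst' := valid_swap vst; have := cyc_new_cluster vst'.
rewrite append_swap => new'; have {new'} new' := new' _ _ _ _ _ _ _ _ _ _ sG xH yH nE tK.
have cy1 := cyc_rot cy; have cy2 := cyc_rot cy1; have cy3 := cyc_rot cy2.
have q1 : Q = gunion4 B C D A := gunion4_rot A B C D.
have q2 : Q = gunion4 C D A B by rewrite q1 gunion4_rot.
have q3 : Q = gunion4 D A B C by rewrite q2 gunion4_rot.
case: (kind A cA) => [sA|eA|eA].
- case: (kind B cB) => [sB|eB|eB].
  + case: (kind C cC) => [sC|eC|eC].
    * case: (kind D cD) => [sD|eD|eD].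
      - have sH : subgraph H H' by rewrite /H' /append_step -gunionA subgraph_unionl.
        apply: (step_extend vst); rewrite ?(subV sA uA) ?(subV sB wB) //.
        by apply: IH cy _ _ _ _ uA uB wB wA; apply: cluster_sub sH _ _.
      - by apply: swap; rewrite q3; apply: new cy3 cD cA cB cC eD.
      - by apply: swapT'; rewrite q3; apply: new' cy3 cD cA cB cC eD.
    * by apply: swap; rewrite q2; apply: new cy2 cC cD cA cB eC.
    * by apply: swapT'; rewrite q2; apply: new' cy2 cC cD cA cB eC.
  + by apply: swap; rewrite q1; apply: new cy1 cB cC cD cA eB.
  + by apply: swapT'; rewrite q1; apply: new' cy1 cB cC cD cA eB.
- by apply: swap; apply: new cy cA cB cC cD eA.
- by apply: swapT'; apply: new' cy cA cB cC cD eA.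
Qed.

(** * Stages of a construction *)

Lemma gedge_eq x y x' y' : x != y -> x' != y' -> [set x; y] = [set x'; y'] ->
  gedge x y = gedge x' y'.
Proof. by move=> n n' e; apply: graph_eq; rewrite ?gE_gedge // e. Qed.

Lemma step_atE st0 (s : seq (step T)) (k : 'I_(size s)) : step_at k = nth st0 s k.
Proof. by rewrite /step_at (tnth_nth st0). Qed.

Lemma stageS st0 f (s : seq (step T)) k : k < size s ->
  stage f s k.+1 = append_step (stage f s k) (nth st0 s k).
Proof. by move=> lt_k; rewrite /stage (take_nth st0) // foldl_rcons. Qed.

Lemma stage_sub f (s : seq (step T)) k m : k <= m ->
  subgraph (stage f s k) (stage f s m).
Proof.
elim: m => [|m IHm]; first by rewrite leqn0 => /eqP->; apply: subgraph_refl.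
rewrite leq_eqVlt => /predU1P[->|/IHm sk]; first exact: subgraph_refl.
apply: subgraph_trans sk _; case: (ltnP m (size s)) => [lt_m|le_s].
  rewrite (stageS (tnth (in_tuple s) (Ordinal lt_m))) // /append_step -gunionA.
  exact: subgraph_unionl.
(* Beyond the last step, [take] returns all of [s] and the stage is constant. *)
by rewrite /stage !take_oversize ?subgraph_refl // leqW.
Qed.

Section Construction.

Variables (G : graph T) (p q : T) (s : seq (step T)) (st0 : step T).
Hypothesis conG : construction G (p, q) s.
Local Notation H k := (stage (p, q) s k).
Local Notation st k := (nth st0 s k).

Lemma construction_step k : k < size s -> valid_step G (H k) (st k).
Proof.
move=> lt_k; have [_ vs _] := conG.
by have := vs (Ordinal lt_k); rewrite (step_atE st0).
Qed.

Lemma construction_sub k : subgraph (H k) G.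
Proof.
have [_ _ e] := conG; have := stage_sub (p, q) s (leq_maxl k (size s)).
suff -> : stage (p, q) s (maxn k (size s)) = G by [].
by rewrite -[RHS]e /stage !take_oversize ?leq_maxr.
Qed.

Lemma construction_base k : p \in gV (H k) /\ q \in gV (H k).
Proof. by split; apply: (subV (stage_sub _ _ (leq0n k))); rewrite /stage take0 !inE eqxx ?orbT. Qed.

Lemma base_neq : p != q.
Proof. by have [[/and4P[]]] := conG. Qed.

Lemma base_edge : [set p; q] \notin gE G.
Proof. by have [[/and4P[]]] := conG. Qed.

Lemma extend_stages x y n k : n <= k <= size s -> x \in gV (H n) -> y \in gV (H n) ->
  td (add_edge (H n) (x, y)) -> td (add_edge (H k) (x, y)).
Proof.
case/andP; elim: k => [|k IHk]; first by rewrite leqn0 => /eqP->.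
rewrite leq_eqVlt ltnS => /predU1P[-> //|le_nk] lt_k xH yH tH.
have sH := stage_sub (p, q) s le_nk; rewrite (stageS st0) //.
apply: (step_extend (construction_step lt_k)); rewrite ?(subV sH xH) ?(subV sH yH) //.
exact: IHk le_nk (ltnW lt_k) xH yH tH.
Qed.

Lemma stage_td k : k <= size s -> td (add_edge (H k) (p, q)).
Proof.
move=> le_k; have [pH qH] := construction_base 0.
apply: (extend_stages (n := 0)) => //.
have -> : add_edge (H 0) (p, q) = gedge p q; last exact: td_edge base_neq.
rewrite /stage take0 /add_edge gunionC gunion_idr //.
by apply/subgraphP; split=> // e; rewrite inE.
Qed.

Lemma step_vertex_in k : k < size s -> step_vertex (st k) \in gV (H k.+1).
Proof.
move=> lt_k; have [_ /capP[vT _ _] _ _ _] := construction_step lt_k.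
by rewrite (stageS st0) // !inE vT orbT.
Qed.

Lemma step_vertex_inj i j : i < size s -> j < size s ->
  step_vertex (st i) = step_vertex (st j) -> i = j.
Proof.
wlog le_ij : i j / i <= j.
  by move=> wl hi hj e; case: (leqP i j) => [|/ltnW] le; [|symmetry]; apply: wl.
move=> hi hj e; apply/eqP; move: le_ij; rewrite leq_eqVlt => /orP[//|lt_ij].
have [_ _ /negP nv _] := step_facts (construction_step hj); case: nv.
by rewrite -e; apply: (subV (stage_sub (p, q) s lt_ij)); apply: step_vertex_in.
Qed.

(** Stage 0 has only the vertices [p] and [q], and a step attaches at two different ones. *)
Lemma first_step_based : 0 < size s -> based_on (p, q) (st 0).
Proof.
move=> s_gt0; have [uH wH _ _] := step_facts (construction_step s_gt0).
have [_ _ _ _] := construction_step s_gt0.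
move: uH wH; rewrite /based_on /stage take0 !inE => /pred2P[]-> /pred2P[]->; rewrite ?eqxx //.
by rewrite setUC.
Qed.

(** From stage 1 on even [p] and [q] lie in clusters, namely those of the first step. *)
Lemma stage_mem x k : 0 < k -> k <= size s -> x \in gV (H k) ->
  exists2 m, m < k & contains_step (st m) x.
Proof.
case: k => // k _; elim: k => [|k IHk] lt_k; rewrite (stageS st0) // !inE -orbA.
  rewrite /stage take0 !inE; case/orP=> [xpq|xT]; exists 0 => //; move/eqP: (first_step_based lt_k) => e.
  have : x \in [set step_u (st 0); step_w (st 0)] by rewrite e !inE.
  have [_ _ /capP[uT _ _] /capP[wT _ _] _] := construction_step lt_k.
  by rewrite /contains_step => /set2P[]->; rewrite ?uT ?wT ?orbT.
case/orP=> [/(IHk (ltnW lt_k))[m lt_m xm]|xT]; last by exists k.+1.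
by exists m => //; apply: leqW.
Qed.

(** Induction on the stage by [append_four_cycle]; stage 0 has no edge and hence no cluster. *)
Lemma four_cycle_extreme n : n <= size s ->
  (forall k, k < n -> td (add_edge (H k) (step_u (st k), step_w (st k)))) ->
  forall u w A B C D a b c d, cyc A B C D a b c d ->
     cluster (H n) A -> cluster (H n) B -> cluster (H n) C -> cluster (H n) D ->
     u \in gV A -> u \notin gV B -> w \in gV B -> w \notin gV A ->
     td (add_edge (H n) (u, w)).
Proof.
elim: n => [|n IHn] lt_n tH u w A B C D a b c d cy cA cB cC cD.
  have [sA tA _] := cA; have [e eA _] := td_edge_mem tA.
  by have := subE sA eA; rewrite /stage take0 inE.
have [pH qH] := construction_base n; have sG := construction_sub n.+1.
rewrite (stageS st0) // in cA cB cC cD sG *.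
apply: (append_four_cycle (construction_step lt_n) sG pH qH base_edge
  (stage_td (ltnW lt_n)) (tH n (leqnn _)) _ cy cA cB cC cD).
by move=> *; apply: (IHn _ _ u w) => //; [exact: ltnW | move=> k hk; apply/tH/ltnW | eassumption..].
Qed.

(** * Levels of step vertices *)

Lemma size_levels f (s' : seq (step T)) j : size (levels f s' j) = j.+1.
Proof. by elim: j => //= j IHj; rewrite size_rcons IHj. Qed.

Lemma nth_levels f (s' : seq (step T)) i j : i <= j ->
  nth set0 (levels f s' j) i = level f s' i.
Proof.
move=> le_ij; rewrite -(subnKC le_ij); elim: (j - i) => [|d IHd]; first by rewrite addn0.
by rewrite addnS /= nth_rcons size_levels ltnS leq_addr.
Qed.

Lemma levelS f (s' : seq (step T)) j :
  level f s' j.+1 = next_level f s' j (levels f s' j).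
Proof. by rewrite /level /= nth_rcons size_levels ltnn eqxx. Qed.

Definition touches_level f (s' : seq (step T)) x i :=
  has (fun t => (step_vertex t \in level f s' i) && contains_step t x) s'.

(** Cutting the list of levels off at [j] does not affect a smallest level that is at most [j],
    since [find] meets it first. *)
Lemma min_levelE f (s' : seq (step T)) x j m : m <= j -> touches_level f s' x m ->
  (forall i, touches_level f s' x i -> m <= i) ->
  min_level s' (levels f s' j) x = m.
Proof.
move=> le_mj hm mn; rewrite /min_level; set a := fun L => _.
have aE i : i <= j -> a (nth set0 (levels f s' j) i) = touches_level f s' x i.
  by move=> le_ij; rewrite /a nth_levels.
apply/eqP; rewrite eqn_leq; apply/andP; split.
  by rewrite leqNgt; apply/negP=> /(before_find set0); rewrite aE // hm.
have ha : has a (levels f s' j).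
  by apply/(has_nthP set0); exists m; rewrite ?size_levels ?ltnS ?aE.
have := nth_find set0 ha; rewrite aE; first exact: mn.
by rewrite -ltnS -(size_levels f s' j) -has_find.
Qed.

Lemma level_based f (s' : seq (step T)) i v : 1 < i -> v \in level f s' i ->
  exists2 j, j < size s' &
    step_vertex (nth st0 s' j) = v /\ ~~ based_on f (nth st0 s' j).
Proof.
case: i => [|[|i]] // _; rewrite levelS inE /= => /(has_nthP st0)[j lt_j /andP[/eqP e /andP[nb _]]].
by exists j.
Qed.

(** Strong induction: the attachment vertices of a step that is not based lie in clusters of earlier
    steps, which already have levels, so the recursion places the step above level 1. *)
Lemma step_level k : k < size s -> exists2 i, 0 < i &
  step_vertex (st k) \in level (p, q) s i /\ (based_on (p, q) (st k) \/ 1 < i).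
Proof.
elim/ltn_ind: k => k IHk lt_k; case: (boolP (based_on (p, q) (st k))) => [bk|nbk].
  exists 1 => //; split; last by left.
  by rewrite levelS inE /=; apply/(has_nthP st0); exists k; rewrite // eqxx.
have k_gt0 : 0 < k.
  by case: (k) nbk lt_k => // /negP nb /first_step_based.
have [uH wH _ _] := step_facts (construction_step lt_k).
have minl x : x \in gV (H k) -> exists2 m, 0 < m & touches_level (p, q) s x m /\
    forall i, touches_level (p, q) s x i -> m <= i.
  move=> xH; have [m lt_m xm] := stage_mem k_gt0 (ltnW lt_k) xH.
  have lt_ms := ltn_trans lt_m lt_k; have [i _ [vi _]] := IHk m lt_m lt_ms.
  have ex : exists i, touches_level (p, q) s x i.
    by exists i; apply/(has_nthP st0); exists m; rewrite // vi.
  (* The smallest level is not 0, because no step vertex is [p] or [q]. *)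
  case: (ex_minnP ex) => n hn mn; exists n => //; case: n hn {mn} => // /(has_nthP st0)[j lt_j].
  case/andP=> + _; rewrite /level /= => /set2P e.
  have [pH qH] := construction_base j.
  have [_ _ /negP nv _] := step_facts (construction_step lt_j); case: nv.
  by case: e => ->.
have [mu mu0 [hu minu]] := minl _ uH; have [mw mw0 [hw minw]] := minl _ wH.
exists (maxn mu mw).+1 => //; split; last by right; rewrite ltnS leq_max mu0.
rewrite levelS inE; apply/(has_nthP st0); exists k => //.
rewrite eqxx eqn0Ngt leq_max mu0 /= nbk /=.
by rewrite (min_levelE (m := mu)) ?leq_maxl // (min_levelE (m := mw)) ?leq_maxr.
Qed.

(** * Extreme graphs and four-cycles *)

Lemma based_extreme k : k < size s -> based_on (p, q) (st k) ->
  td (add_edge (H k) (step_u (st k), step_w (st k))).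
Proof.
move=> lt_k /eqP e; have [_ _ _ _ nuw] := construction_step lt_k.
by rewrite /add_edge (gedge_eq nuw base_neq e); apply: stage_td (ltnW lt_k).
Qed.

(** Strong induction on the step. A based step has the base edge as its extreme edge; any other step
    has a four-cycle, and [four_cycle_extreme] applies because the earlier extreme graphs are td. *)
Lemma extreme_of_four_cycles :
  (forall k, k < size s ->
     (exists2 i, 2 <= i & step_vertex (st k) \in level (p, q) s i) ->
     exists2 S : {set graph T}, four_cycle_of_clusters (H k) S &
       in_adjacent_pair S (step_u (st k)) (step_w (st k))) ->
  forall k, k < size s -> td (add_edge (H k) (step_u (st k), step_w (st k))).
Proof.
move=> fc; elim/ltn_ind => k IHk lt_k.
have [i _ [vi [bk|i_gt1]]] := step_level lt_k; first exact: based_extreme.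
have [|S cS [A [B [adj suw]]]] := fc k lt_k; first by exists i.
have vst := construction_step lt_k; have tK := stage_td (ltnW lt_k).
have [C [D [a [b [c [d [cy [cA cB cC cD]]]]]]]] :=
  adjacent_cyc tK (subgraph_unionl _ _) cS adj.
have uAB : step_u (st k) \in gV A :|: gV B by apply: (subsetP suw); rewrite set21.
have wAB : step_w (st k) \in gV A :|: gV B by apply: (subsetP suw); rewrite set22.
(* No cluster contains both attachment vertices, so one lies only in [A] and the other only in
   [B]. *)
have noboth X : cluster (H k) X -> step_u (st k) \in gV X ->
    step_w (st k) \in gV X -> False.
  move=> [sX tX _]; apply: (step_not_both vst tX); last exact: subV.
  exact: subgraph_trans sX (construction_sub k).
have IH k' : k' < k -> td (add_edge (H k') (step_u (st k'), step_w (st k'))).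
  by move=> lt_k'; apply: IHk => //; apply: ltn_trans lt_k' lt_k.
have main := four_cycle_extreme (ltnW lt_k) IH.
case uA : (step_u (st k) \in gV A).
  have wA : step_w (st k) \notin gV A by apply/negP=> wA; apply: (noboth A).
  have wB : step_w (st k) \in gV B by move: wAB; rewrite inE (negPf wA).
  have uB : step_u (st k) \notin gV B by apply/negP=> uB; apply: (noboth B).
  exact: main cy cA cB cC cD uA uB wB wA.
have uB : step_u (st k) \in gV B by move: uAB; rewrite inE uA.
have wB : step_w (st k) \notin gV B by apply/negP=> wB; apply: (noboth B).
have wA : step_w (st k) \in gV A by move: wAB; rewrite inE (negPf wB) orbF.
(* The reflected cycle starts with [B] and [A], in this order. *)
have := cyc_rev (cyc_rot cy) => cy'.
exact: main cy' cB cA cD cC uB (negbT uA) wA wB.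
Qed.

(** After two steps the stage contains three different clusters of [G]: both of the first step and
    one of the second. The first alternative of [adjacent_dichotomy] has room for only two. *)
Lemma four_cycle_of_extreme k : 1 < k -> k < size s ->
  td (add_edge (H k) (step_u (st k), step_w (st k))) ->
  exists2 S : {set graph T}, four_cycle_of_clusters (H k) S &
       in_adjacent_pair S (step_u (st k)) (step_w (st k)).
Proof.
move=> k_gt1 lt_k tk; have vst := construction_step lt_k.
have [uH wH _ _] := step_facts vst; have [_ _ _ _ nuw] := vst.
have sG := construction_sub k.
have nE : [set step_u (st k); step_w (st k)] \notin gE (H k).
  by apply: contra (step_no_edge vst); apply: subE.
have lt1 : 1 < size s := ltn_trans k_gt1 lt_k; have lt0 : 0 < size s := ltnW lt1.
have [[c0 c0'] e0 _ _ _] := construction_step lt0.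
have [[c1 _] _ /capP[_ _ u1] _ _] := construction_step lt1.
have s1 : subgraph (H 1) (H k) by apply: stage_sub; apply: ltnW.
have s2 : subgraph (H 2) (H k) by apply: stage_sub.
have sT0 : subgraph (step_T (st 0)) (H 1).
  by rewrite (stageS st0) // /append_step gunionAC subgraph_unionr.
have sT0' : subgraph (step_T' (st 0)) (H 1).
  by rewrite (stageS st0) // /append_step subgraph_unionr.
have sT1 : subgraph (step_T (st 1)) (H k).
  apply: subgraph_trans s2.
  by rewrite (stageS st0) // /append_step gunionAC subgraph_unionr.
have [sG0 t0 _] := c0; have [sG0' t0' _] := c0'; have [sG1 t1 _] := c1.
have [[A [B [tA tB sA sB AB]]]|//] := adjacent_dichotomy nuw nE uH wH tk t1 sT1.
have isAB X : cluster G X -> subgraph X (H k) -> X = A \/ X = B.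
  move=> cX sX; have [sXG tX _] := cX.
  by case: (AB X tX sX) => sXA; [left|right]; apply: (cluster_eq cX _ _ sXA) => //;
    apply: subgraph_trans sG.
have n00 : step_T (st 0) <> step_T' (st 0).
  by move=> e; have := td_cap_not_sub t0' e0; rewrite e subgraph_refl.
have n01 X : subgraph X (H 1) -> step_T (st 1) <> X.
  move=> sX e; have [y yT] := td_other (step_u (st 1)) t1.
  by rewrite (u1 y yT) ?eqxx // (subV sX) // -e.
have := isAB _ c0 (subgraph_trans sT0 s1); have := isAB _ c0' (subgraph_trans sT0' s1).
have := isAB _ c1 sT1; have := n01 _ sT0; have := n01 _ sT0'.
by move=> h1 h2 [] e1 [] e2 [] e3; exfalso;
  first [by apply: n00; rewrite e2 e3 | by apply: h1; rewrite e1 e2 | by apply: h2; rewrite e1 e3].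
Qed.

Lemma high_level_not_based k i : k < size s -> 1 < i ->
  step_vertex (st k) \in level (p, q) s i -> ~~ based_on (p, q) (st k).
Proof.
move=> lt_k i_gt1 /(level_based i_gt1)[j lt_j [e]].
by rewrite (step_vertex_inj lt_j lt_k e).
Qed.

End Construction.

(** * Changing the base nonedge *)

(** Stage 1 is the union of the two clusters of [a], and the attachment vertices of [b] lie in
    different ones; so these clusters can be appended to that pair instead of [p], [q]. The extreme
    graph of [b] makes the pair a base nonedge. *)
Lemma rebase G p q a b (r : seq (step T)) :
  construction G (p, q) [:: a, b & r] ->
  td (add_edge (stage (p, q) [:: a, b & r] 1) (step_u b, step_w b)) ->
  exists a', [/\ construction G (step_u b, step_w b) [:: a', b & r],
     based_on (step_u b, step_w b) a' &
     forall k, stage (step_u b, step_w b) [:: a', b & r] k.+1 =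
               stage (p, q) [:: a, b & r] k.+1].
Proof.
move=> conG tb; set s := [:: a, b & r] in conG tb *.
have va := construction_step (k := 0) a conG isT.
have vb := construction_step (k := 1) a conG isT.
rewrite /= in va vb; have [uH wH _ _] := step_facts vb; have [_ _ _ _ nuw] := vb.
have sG := construction_sub conG.
have [[cT cT'] eTT eT eT' _] := va.
have e1 : stage (p, q) s 1 = append_step (gpair p q) a by [].
have sT : subgraph (step_T a) (stage (p, q) s 1).
  by rewrite e1 /append_step gunionAC subgraph_unionr.
have sT' : subgraph (step_T' a) (stage (p, q) s 1) by rewrite e1 subgraph_unionr.
have inTT x : x \in gV (stage (p, q) s 1) -> x \in gV (step_T a) \/ x \in gV (step_T' a).
  by move/(stage_mem a conG (k := 1) isT isT) => [[|//] _ /= /orP].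
have noboth X : cluster G X -> subgraph X (stage (p, q) s 1) ->
    step_u b \in gV X -> step_w b \in gV X -> False.
  by move=> [sX tX _] sX1; apply: (step_not_both vb tX sX); exact: subV.
have build X X' : cluster G X -> cluster G X' -> gV X :&: gV X' = [set step_vertex a] ->
    step_u b \in gV X -> step_u b \notin gV X' -> step_w b \in gV X' ->
    step_w b \notin gV X ->
    gunion X X' = gunion (step_T a) (step_T' a) ->
    exists a', [/\ construction G (step_u b, step_w b) [:: a', b & r],
     based_on (step_u b, step_w b) a' &
     forall k, stage (step_u b, step_w b) [:: a', b & r] k.+1 = stage (p, q) s k.+1].
  move=> cX cX' eXX uX uX' wX' wX eU.
  pose a' := Step (step_vertex a) (step_u b) (step_w b) X X'.
  have est k : stage (step_u b, step_w b) [:: a', b & r] k.+1 = stage (p, q) s k.+1.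
    (* Old and new base vertices lie in the two clusters, so neither pair adds anything to stage
       1. *)
    rewrite /stage /=; congr foldl; rewrite /append_step -!gunionA /= eU.
    apply: subgraph_anti; rewrite gunion_sub.
      rewrite subgraph_unionr andbT; apply/subgraphP; split=> x; rewrite ?inE //.
      by case/pred2P=> ->; apply/orP; right; apply/orP; apply: inTT.
    rewrite subgraph_unionr andbT; apply/subgraphP; split=> x; rewrite ?inE //.
    have [p1 q1] := construction_base p q s 1.
    by case/pred2P=> ->; apply/orP; right; apply/orP; apply: inTT.
  exists a'; split=> //; last by rewrite /based_on eqxx.
  have [[ne0 td0] vs ends] := conG; split.
  - split.
      by apply/and4P; split; rewrite ?(subV (sG 1) uH) ?(subV (sG 1) wH) ?(step_no_edge vb).
    have := extend_stages a conG (n := 1) (k := size s) _ uH wH tb.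
    by rewrite ends; apply; rewrite leqnn.
  - case=> -[|k] hk; rewrite (step_atE a) /=.
      split=> //; apply/capP; split=> //; rewrite ?inE ?eqxx ?orbT //.
        by move=> y yX; rewrite !inE => /pred2P[] // e; rewrite e (negPf wX) in yX.
      by move=> y yX; rewrite !inE => /pred2P[] // e; rewrite e (negPf uX') in yX.
    by rewrite est; apply: (construction_step a conG (k := k.+1)).
  by rewrite est.
case: (inTT _ uH) => uT; case: (inTT _ wH) => wT.
- by case: (noboth (step_T a)).
- apply: (build (step_T a) (step_T' a)) => //; apply/negP=> h.
    exact: (noboth (step_T' a)).
  exact: (noboth (step_T a)).
- apply: (build (step_T' a) (step_T a)); rewrite // 1?setIC 1?gunionC //; apply/negP=> h.
    exact: (noboth (step_T a)).
  exact: (noboth (step_T' a)).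
- by case: (noboth (step_T' a)).
Qed.

End Graphs.

Theorem theorem2 (T : finType) (G : graph T)
    (G_1dof : one_dof G) (G_6clusters : at_least_clusters 6 G) :
  nontrivially_lcc G <->
  exists (f : T * T) (s : seq (step T)),
    construction G f s /\
    forall k : 'I_(size s),
      (exists2 i : nat, 2 <= i & step_vertex (step_at k) \in level f s i) ->
      exists2 S : {set graph T},
        four_cycle_of_clusters (stage f s k) S &
        in_adjacent_pair S (step_u (step_at k)) (step_w (step_at k)).
Proof.
split=> [[[[p q] [s conG ext]] _]|[[p q] [s [conG fc]]]]; last first.
  split; last by case.
  exists (p, q), s => // k; have lt_k := ltn_ord k; pose st0 := step_at k.
  rewrite /extreme_graph (step_atE st0).
  apply: (extreme_of_four_cycles conG) lt_k => j lt_j.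
  by have := fc (Ordinal lt_j); rewrite (step_atE st0).
(* With at most one step nothing reaches level 2 and the base nonedge is kept; otherwise the second
   step [b] provides the new one. *)
case: s conG ext => [|a [|b r]] conG ext.
- by exists (p, q), [::]; split=> // -[].
- exists (p, q), [:: a]; split=> // -[[|//] hk] [i i_gt1].
  rewrite (step_atE a) => vi.
  by have /negP[] := high_level_not_based conG hk i_gt1 vi; apply: (first_step_based a conG).
have ext' k (lt_k : k < (size r).+2) := ext (Ordinal lt_k).
have tb : tree_decomposable (add_edge (stage (p, q) [:: a, b & r] 1) (step_u b, step_w b)).
  by have := ext' 1 isT; rewrite /extreme_graph (step_atE a).
have [a' [conG' based_a' est]] := rebase conG tb.
exists (step_u b, step_w b), [:: a', b & r]; split=> // k [i i_gt1].
have lt_k := ltn_ord k; rewrite (step_atE a) => vi.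
have := high_level_not_based conG' lt_k i_gt1 vi.
(* The first two steps are based on the new pair, so they are not at level 2 or higher; the others
   see the same stages as before. *)
case: k lt_k {vi} => -[|[|k]] hk lt_k /=; rewrite ?based_a' ?/based_on ?eqxx // => _.
apply: (four_cycle_of_extreme (k := k.+2) (st0 := a) conG') => //.
by rewrite est; have := ext' k.+2 lt_k; rewrite /extreme_graph (step_atE a).
Qed.
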